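(* Let $m>0$, $\ell_1,\ell_2,\ell_3>0$ and $\zeta\in\frac{2\pi}{\ell_3}\mathbb{Z}$. For any $\nu\in(1,2)$ there exist $\kappa_1>0$ and $\kappa_2>0$ such that for all $\varphi\in L^4(\mathbb{T}^2,\mathbb{C}^4)$, $$\|\varphi\|_{L^4}=1,\quad \|\bar\varphi\varphi\|_{L^\nu}\le\kappa_1\quad\Longrightarrow\quad\|\mathrm{Pr}_{m,\zeta}^\perp\varphi\|_{L^4}\ge\kappa_2 .$$
   Context: $\mathbb{T}^2=\mathbb{R}^2/(\ell_1\mathbb{Z}\times\ell_2\mathbb{Z})$. $\gamma^0=\begin{pmatrix}I_2&0\\0&-I_2\end{pmatrix}$, $\gamma^k=\begin{pmatrix}0&\sigma^k\\-\sigma^k&0\end{pmatrix}$ for $k=1,2,3$, with Pauli matrices $\sigma^1=\begin{pmatrix}0&1\\1&0\end{pmatrix}$, $\sigma^2=\begin{pmatrix}0&-i\\i&0\end{pmatrix}$, $\sigma^3=\begin{pmatrix}1&0\\0&-1\end{pmatrix}$. $\bar\varphi\varphi:=\langle\gamma^0\varphi,\varphi\rangle=|\varphi^1|^2+|\varphi^2|^2-|\varphi^3|^2-|\varphi^4|^2$. $\mathbf{D}_{\mathbb{T}^2}:=-i\sum_{k=1}^2\gamma^0\gamma^k\partial_k+\zeta\gamma^0\gamma^3+m\gamma^0$ acts on $\mathbb{C}^4$-valued functions on $\mathbb{T}^2$; it is self-adjoint with discrete spectrum. $\mathrm{Eigen}(\mathbf{D}_{\mathbb{T}^2};\sqrt{\zeta^2+m^2})$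 is its eigenspace for the lowest positive eigenvalue $\sqrt{\zeta^2+m^2}$. $\mathrm{Pr}_{m,\zeta}$ is the $L^2$-orthogonal projection onto this eigenspace and $\mathrm{Pr}_{m,\zeta}^\perp=\mathrm{Id}-\mathrm{Pr}_{m,\zeta}$. *)

(* Defs.v *)
From HB Require Import structures.
From mathcomp Require Import all_boot all_order all_algebra.
From mathcomp Require Import all_classical all_reals all_analysis.
From mathcomp Require Import complex.

Set Implicit Arguments.
Unset Strict Implicit.
Unset Printing Implicit Defensive.

Import Order.TTheory GRing.Theory Num.Theory.
Import numFieldNormedType.Exports.

Local Open Scope classical_set_scope.
Local Open Scope ring_scope.
Local Open Scope complex_scope.

(** Functions on the torus R^2/(l1 Z x l2 Z) are represented by functions on
    the plane with periods (l1, 0) and (0, l2); integration over the torus is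
    integration over the fundamental cell [0, l1[ x [0, l2[.  Elements of L^p
    are represented by Borel functions, and equality in L^p is equality almost
    everywhere. *)

Definition cell (R : realType) (l1 l2 : R) :
    set (measurableTypeR R * measurableTypeR R) :=
  `[0, l1[%classic `*` `[0, l2[%classic.

Lemma measurable_cell (R : realType) (l1 l2 : R) : measurable (cell l1 l2).
Proof. by apply: measurableX; exact: measurable_itv. Qed.

Definition torus_measure (R : realType) (l1 l2 : R) :
    {measure set (measurableTypeR R * measurableTypeR R) -> \bar R} :=
  mrestr (lebesgue_measure \x lebesgue_measure)%E (measurable_cell l1 l2).

Definition spinor (R : realType) : Type := 'cV[R[i]]_(2 + 2).

Definition spinor_field (R : realType) : Type := (R * R)%type -> spinor R.

Definition periodic (R : realType) (l1 l2 : R) (u : spinor_field R) : Prop :=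
  forall x : R * R, u (x.1 + l1, x.2) = u x /\ u (x.1, x.2 + l2) = u x.

Definition measurable_field (R : realType) (u : spinor_field R) : Prop :=
  forall j : 'I_(2 + 2),
    measurable_fun setT (fun x : measurableTypeR R * measurableTypeR R =>
      complex.Re (u x j 0) : measurableTypeR R) /\
    measurable_fun setT (fun x : measurableTypeR R * measurableTypeR R =>
      complex.Im (u x j 0) : measurableTypeR R).

Definition hdot (R : realType) (a b : spinor R) : R[i] :=
  \sum_j a j 0 * (b j 0)^*.

Definition spinor_norm (R : realType) (a : spinor R) : R :=
  Num.sqrt (complex.Re (hdot a a)).

(** The L^p norm over the torus of a scalar function. *)
Definition Lnorm_torus (R : realType) (l1 l2 : R) (p : R)
    (f : (R * R)%type -> R) : \bar R :=
  ('N[torus_measure l1 l2]_p%:E[EFin \o f])%E.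

(** The L^p norm over the torus of a spinor field. *)
Definition Lnorm_field (R : realType) (l1 l2 : R) (p : R)
    (u : spinor_field R) : \bar R :=
  Lnorm_torus l1 l2 p (fun x => spinor_norm (u x)).

Definition Lp_field (R : realType) (l1 l2 : R) (p : R) :
    set (spinor_field R) :=
  [set u | [/\ periodic l1 l2 u, measurable_field u &
             (Lnorm_field l1 l2 p u < +oo)%E]].

Definition L2dot (R : realType) (l1 l2 : R) (u v : spinor_field R) : R[i] :=
  (\int[torus_measure l1 l2]_x complex.Re (hdot (u x) (v x))) +i*
  (\int[torus_measure l1 l2]_x complex.Im (hdot (u x) (v x))).

Definition mat2 (R : realType) (a b c d : R[i]) : 'M[R[i]]_2 :=
  \matrix_(i < 2, j < 2)
    (if i == 0 then (if j == 0 then a else b) else (if j == 0 then c else d)).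

Definition sigma1 (R : realType) : 'M[R[i]]_2 := mat2 0 1 1 0.
Definition sigma2 (R : realType) : 'M[R[i]]_2 := mat2 0 (- 'i) 'i 0.
Definition sigma3 (R : realType) : 'M[R[i]]_2 := mat2 1 0 0 (- 1).

Definition gamma0 (R : realType) : 'M[R[i]]_(2 + 2) :=
  block_mx 1%:M 0 0 (- 1%:M).

Definition gamma_of (R : realType) (s : 'M[R[i]]_2) : 'M[R[i]]_(2 + 2) :=
  block_mx 0 s (- s) 0.

Definition gamma1 (R : realType) : 'M[R[i]]_(2 + 2) := gamma_of (sigma1 R).
Definition gamma2 (R : realType) : 'M[R[i]]_(2 + 2) := gamma_of (sigma2 R).
Definition gamma3 (R : realType) : 'M[R[i]]_(2 + 2) := gamma_of (sigma3 R).

(** The scalar density [<gamma0 phi, phi>], which is real since [gamma0] is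
    Hermitian. *)
Definition bar_density (R : realType) (u : spinor_field R)
    (x : (R * R)%type) : R :=
  complex.Re (hdot (gamma0 R *m u x) (u x)).

Definition e1 (R : realType) : (R * R)%type := (1, 0).
Definition e2 (R : realType) : (R * R)%type := (0, 1).

Fixpoint is_Cn (R : realType) (n : nat) (f : (R * R)%type -> R) : Prop :=
  match n with
  | 0 => continuous f
  | n'.+1 => [/\ forall x, differentiable f x,
                 is_Cn n' ('D_(e1 R) f) & is_Cn n' ('D_(e2 R) f)]
  end.

Definition smooth (R : realType) (f : (R * R)%type -> R) : Prop :=
  forall n, is_Cn n f.

Definition smooth_field (R : realType) (u : spinor_field R) : Prop :=
  forall j : 'I_(2 + 2), smooth (fun x => complex.Re (u x j 0)) /\
                         smooth (fun x => complex.Im (u x j 0)).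

Definition partial (R : realType) (v : (R * R)%type) (u : spinor_field R) :
    spinor_field R :=
  fun x => \col_j ('D_v (fun y => complex.Re (u y j 0)) x +i*
                   'D_v (fun y => complex.Im (u y j 0)) x).

Definition L2_cvg (R : realType) (l1 l2 : R) (un : nat -> spinor_field R)
    (u : spinor_field R) : Prop :=
  (fun n => Lnorm_field l1 l2 2 (fun x => un n x - u x)) @ \oo --> 0%E.

(** [u] belongs to the Sobolev space H^1 of the torus, with partial
    derivatives [w1] and [w2]: H^1 is the completion of the smooth periodic
    fields for the H^1 norm. *)
Definition H1_partials (R : realType) (l1 l2 : R)
    (u w1 w2 : spinor_field R) : Prop :=
  [/\ Lp_field l1 l2 2 u, Lp_field l1 l2 2 w1, Lp_field l1 l2 2 w2 &
    exists un : nat -> spinor_field R,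
      [/\ forall n, periodic l1 l2 (un n) /\ smooth_field (un n),
          L2_cvg l1 l2 un u,
          L2_cvg l1 l2 (fun n => partial (e1 R) (un n)) w1 &
          L2_cvg l1 l2 (fun n => partial (e2 R) (un n)) w2]].

(** The Dirac expression, [w1] and [w2] standing for the partial derivatives
    of [u]. *)
Definition dirac_expr (R : realType) (m zeta : R)
    (u w1 w2 : spinor_field R) : spinor_field R :=
  fun x =>
    - 'i *: (gamma0 R *m gamma1 R *m w1 x + gamma0 R *m gamma2 R *m w2 x)
    + zeta%:C *: (gamma0 R *m gamma3 R *m u x) + m%:C *: (gamma0 R *m u x).

(** [D u = f] for the self-adjoint Dirac operator, whose domain is H^1. *)
Definition dirac (R : realType) (m l1 l2 zeta : R)
    (u f : spinor_field R) : Prop :=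
  exists w1 w2 : spinor_field R, H1_partials l1 l2 u w1 w2 /\
    {ae torus_measure l1 l2, forall x, dirac_expr m zeta u w1 w2 x = f x}.

Definition Eigen (R : realType) (m l1 l2 zeta lambda : R) :
    set (spinor_field R) :=
  [set u | dirac m l1 l2 zeta u (fun x => lambda%:C *: u x)].

(** [p] represents the L^2-orthogonal projection of [phi] onto the
    eigenspace.  For [phi] in L^2, such a [p] exists, the eigenspace being finite dimensional,
    and it is unique up to equality almost everywhere. *)
Definition is_Pr (R : realType) (m l1 l2 zeta : R)
    (phi p : spinor_field R) : Prop :=
  let E := Eigen m l1 l2 zeta (Num.sqrt (zeta ^+ 2 + m ^+ 2)) in
  E p /\ forall e, E e -> L2dot l1 l2 (fun x => phi x - p x) e = 0.

(** A representative of the projection; for [phi] in L^2 the default value is not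
    used. *)
Definition Pr (R : realType) (m l1 l2 zeta : R) (phi : spinor_field R) :
    spinor_field R :=
  xget (fun=> 0) [set p | is_Pr m l1 l2 zeta phi p].

Definition Pr_perp (R : realType) (m l1 l2 zeta : R) (phi : spinor_field R) :
    spinor_field R :=
  fun x => phi x - Pr m l1 l2 zeta phi x.

(* Main.v *)
Require Import Defs.
From HB Require Import structures.
From mathcomp Require Import all_boot all_order all_algebra.
From mathcomp Require Import all_classical all_reals all_analysis.
From mathcomp Require Import measurable_realfun.
From mathcomp Require Import complex.
From mathcomp Require Import ring lra.

Import Order.TTheory GRing.Theory Num.Theory.
Import numFieldNormedType.Exports.

Local Open Scope classical_set_scope.
Local Open Scope ring_scope.

(** Why the theorem is true.

    With lam = sqrt (zeta^2 + m^2), the square of the Dirac operator is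
    - Laplacian + lam^2, so a field u with D u = lam u has no Dirichlet energy:
    the eigenspace consists of the constant spinors c that solve the algebraic
    equation (zeta gamma0 gamma3 + m gamma0) c = lam c ([eigen_constant]).
    Pairing this equation with gamma0 c, the zeta-term contributes nothing to
    the real part because gamma3 is anti-Hermitian, and what remains is
    lam <gamma0 c, c> = m |c|^2 ([bar_eigen]).  Thus, on the eigenspace, the
    scalar density controls the whole spinor; this is where m > 0 enters.

    Suppose now that phi has norm one in L^4 and is L^4-close to its projection
    c.  Then |c| is bounded below ([L4_split_le]).  The scalar density of phi
    differs from that of c by at most a small multiple of |c|^2 plus a multiple
    of |phi - c|^2, so if it were small in L^nu then |c| would be small as well
    ([constant_part_le]).  The constants are chosen so that these two facts
    contradict each other.  If phi has no projection, [Pr] is the zero field, and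
    [Pr_perp phi] is phi itself, of norm one.

    Constancy of the eigenfields follows from an energy identity.  For a smooth
    periodic v, the difference between |D v|^2 and
    |d1 v|^2 + |d2 v|^2 + lam^2 |v|^2 is pointwise a combination of exact
    derivatives d_k (f g) and of Jacobians d1 f d2 g - d1 g d2 f
    ([nsq_symbol]).  All of these integrate to zero over the torus
    ([torus_ibp1], [torus_ibp2], [torus_null_jacobian]; the Jacobians need the
    symmetry of second derivatives, [clairaut]), which gives [energy].  Applied
    to smooth v converging in H^1 to an eigenfield u, the identity forces the
    gradients of v to tend to zero in L^2 ([eigen_approx]).  A Poincare
    inequality for the double integral of |f x - f y| ([torus_poincare]) then
    shows that u x = u y for almost all x and y. *)

(** * Spinor algebra *)

(** Written with [lshift] and [rshift] so that the block matrix lemmas apply to them. *)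
Definition c1 : 'I_(2 + 2) := lshift 2 ord0.
Definition c2 : 'I_(2 + 2) := lshift 2 ord_max.
Definition c3 : 'I_(2 + 2) := rshift 2 ord0.
Definition c4 : 'I_(2 + 2) := rshift 2 ord_max.

Section algebra.
Context {R : realType}.
Local Open Scope complex_scope.
Implicit Types a b c : spinor R.

Definition re a (j : 'I_(2 + 2)) : R := complex.Re (a j 0).
Definition im a (j : 'I_(2 + 2)) : R := complex.Im (a j 0).

Lemma sum_components (V : zmodType) (F : 'I_(2 + 2) -> V) :
  \sum_j F j = F c1 + F c2 + F c3 + F c4.
Proof.
rewrite big_split_ord/= !big_ord_recl !big_ord0 !addr0 addrA.
by congr (_ + F _ + F _ + F _); apply: val_inj.
Qed.

Lemma componentP (P : 'I_(2 + 2) -> Prop) :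
  P c1 -> P c2 -> P c3 -> P c4 -> forall j, P j.
Proof.
move=> P1 P2 P3 P4 j.
have : j \in [:: c1; c2; c3; c4] by case: j => -[|[|[|[|//]]]] ?; rewrite !inE.
by rewrite !inE => /or4P[] /eqP ->.
Qed.

Definition nsq a : R := \sum_j (re a j ^+ 2 + im a j ^+ 2).

Lemma nsq_ge0 a : 0 <= nsq a.
Proof. by apply: sumr_ge0 => j _; rewrite addr_ge0 ?sqr_ge0. Qed.

Lemma hdotE a b : complex.Re (hdot a b) =
  \sum_j (re a j * re b j + im a j * im b j).
Proof.
rewrite /hdot raddf_sum/=; apply: eq_bigr => j _.
rewrite /re /im; case: (a j 0) => x y; case: (b j 0) => z t /=.
ring.
Qed.

Lemma spinor_normE a : spinor_norm a = Num.sqrt (nsq a).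
Proof. by rewrite /spinor_norm hdotE. Qed.

Lemma gamma0E a :
  [/\ (gamma0 R *m a) c1 0 = a c1 0, (gamma0 R *m a) c2 0 = a c2 0,
      (gamma0 R *m a) c3 0 = - a c3 0 & (gamma0 R *m a) c4 0 = - a c4 0].
Proof.
by split; rewrite mxE sum_components /gamma0 /c1 /c2 /c3 /c4
  ?(block_mxEul, block_mxEur, block_mxEdl, block_mxEdr) !mxE/=; ring.
Qed.

Definition bar a : R := complex.Re (hdot (gamma0 R *m a) a).

Lemma barE a : bar a =
  (re a c1 ^+ 2 + im a c1 ^+ 2) + (re a c2 ^+ 2 + im a c2 ^+ 2)
  - (re a c3 ^+ 2 + im a c3 ^+ 2) - (re a c4 ^+ 2 + im a c4 ^+ 2).
Proof.
rewrite /bar hdotE sum_components /re /im.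
have [-> -> -> ->] := gamma0E a; rewrite !raddfN/=; ring.
Qed.

(** The Dirac expression at one point, as a function of the values a of the field
    and b, c of its two partial derivatives. *)
Definition symbol m zeta a b c : spinor R :=
  - 'i *: (gamma0 R *m gamma1 R *m b + gamma0 R *m gamma2 R *m c)
    + zeta%:C *: (gamma0 R *m gamma3 R *m a) + m%:C *: (gamma0 R *m a).

Lemma alphaE s : gamma0 R *m gamma_of s = block_mx 0 s s 0.
Proof.
rewrite /gamma0 /gamma_of mulmx_block !mul0mx !mul1mx !mulmx0.
by rewrite !addr0 !add0r mulNmx mul1mx opprK.
Qed.

Lemma alpha_mulE s a :
  let M := gamma0 R *m gamma_of s *m a in
  [/\ M c1 0 = s ord0 ord0 * a c3 0 + s ord0 ord_max * a c4 0,
      M c2 0 = s ord_max ord0 * a c3 0 + s ord_max ord_max * a c4 0,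
      M c3 0 = s ord0 ord0 * a c1 0 + s ord0 ord_max * a c2 0 &
      M c4 0 = s ord_max ord0 * a c1 0 + s ord_max ord_max * a c2 0].
Proof.
rewrite /= alphaE; split; rewrite mxE sum_components /c1 /c2 /c3 /c4
  ?(block_mxEul, block_mxEur, block_mxEdl, block_mxEdr) !mxE/=; ring.
Qed.

Lemma symbolE m zeta a b c :
  let d := symbol m zeta a b c in
  [/\ d c1 0 = - 'i * b c4 0 - c c4 0 + zeta%:C * a c3 0 + m%:C * a c1 0,
      d c2 0 = - 'i * b c3 0 + c c3 0 - zeta%:C * a c4 0 + m%:C * a c2 0,
      d c3 0 = - 'i * b c2 0 - c c2 0 + zeta%:C * a c1 0 - m%:C * a c3 0 &
      d c4 0 = - 'i * b c1 0 + c c1 0 - zeta%:C * a c2 0 - m%:C * a c4 0].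
Proof.
have lin (x y z : R[i]) (A B C D : spinor R) i :
    (x *: (A + B) + y *: C + z *: D) i 0 =
    x * (A i 0 + B i 0) + y * C i 0 + z * D i 0 by rewrite !mxE.
rewrite /symbol /gamma1 /gamma2 /gamma3 /= !lin.
have [-> -> -> ->] := alpha_mulE (sigma1 R) b.
have [-> -> -> ->] := alpha_mulE (sigma2 R) c.
have [-> -> -> ->] := alpha_mulE (sigma3 R) a.
have [-> -> -> ->] := gamma0E a.
rewrite -!complexiE !mxE /= -?complexiE; split; do ?[case: (a _ _) => ? ?];
  do ?[case: (b _ _) => ? ?]; do ?[case: (c _ _) => ? ?];
  apply/eqP; rewrite eq_complex /=; apply/andP; split; apply/eqP; ring.
Qed.

Lemma ReImE (x y : R) (z : R[i]) :
  [/\ complex.Re (- 'i * z) = complex.Im z, complex.Im (- 'i * z) = - complex.Re z,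
   complex.Re (x%:C * z) = x * complex.Re z &
   complex.Im (x%:C * z) = x * complex.Im z].
Proof. by case: z => p q /=; split; ring. Qed.

Lemma symbol_realE m zeta a b c :
  let d := symbol m zeta a b c in
  [/\ re d c1 = im b c4 - re c c4 + zeta * re a c3 + m * re a c1,
      re d c2 = im b c3 + re c c3 - zeta * re a c4 + m * re a c2,
      re d c3 = im b c2 - re c c2 + zeta * re a c1 - m * re a c3 &
      re d c4 = im b c1 + re c c1 - zeta * re a c2 - m * re a c4] /\
  [/\ im d c1 = - re b c4 - im c c4 + zeta * im a c3 + m * im a c1,
      im d c2 = - re b c3 + im c c3 - zeta * im a c4 + m * im a c2,
      im d c3 = - re b c2 - im c c2 + zeta * im a c1 - m * im a c3 &
      im d c4 = - re b c1 + im c c1 - zeta * im a c2 - m * im a c4].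
Proof.
rewrite /= /re /im; have [-> -> -> ->] := symbolE m zeta a b c.
by split; split; rewrite !raddfD/= ?raddfN/=; case: (a _ _) => ? ?; case: (a _ _) => ? ?;
 case: (b _ _) => ? ?; case: (c _ _) => ? ? /=; ring.
Qed.

(** The pointwise energy identity.  With b and c the partial derivatives of a,
    the second summand consists of Jacobians of the real and imaginary parts of
    each component, then of exact derivatives in the first direction, then of exact
    derivatives in the second one: this is what the anticommutation of the Dirac
    matrices leaves of the cross terms.  The real and imaginary parts are passed as
    functions so that they can be instantiated by 'D_v of those of a field. *)
Lemma nsq_symbol m zeta a b c (ra ia rb ib rc ic : 'I_(2 + 2) -> R) :
  re a =1 ra -> im a =1 ia -> re b =1 rb -> im b =1 ib -> re c =1 rc -> im c =1 ic ->
  nsq (symbol m zeta a b c) = (nsq b + nsq c + (zeta ^+ 2 + m ^+ 2) * nsq a)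
  + (2 * ((rb c4 * ic c4 - ib c4 * rc c4) - (rb c3 * ic c3 - ib c3 * rc c3)
        + (rb c2 * ic c2 - ib c2 * rc c2) - (rb c1 * ic c1 - ib c1 * rc c1))
   + 2 * (zeta * ((ib c4 * ra c3 + ia c4 * rb c3) - (rb c4 * ia c3 + ra c4 * ib c3))
        + m * ((ib c4 * ra c1 + ia c4 * rb c1) - (rb c4 * ia c1 + ra c4 * ib c1))
        + m * ((ib c3 * ra c2 + ia c3 * rb c2) - (rb c3 * ia c2 + ra c3 * ib c2))
        + zeta * ((ib c2 * ra c1 + ia c2 * rb c1) - (rb c2 * ia c1 + ra c2 * ib c1)))
   - 2 * (zeta * ((rc c4 * ra c3 + ra c4 * rc c3) + (ic c4 * ia c3 + ia c4 * ic c3))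
        + m * ((rc c4 * ra c1 + ra c4 * rc c1) + (ic c4 * ia c1 + ia c4 * ic c1))
        - m * ((rc c3 * ra c2 + ra c3 * rc c2) + (ic c3 * ia c2 + ia c3 * ic c2))
        + zeta * ((rc c2 * ra c1 + ra c2 * rc c1) + (ic c2 * ia c1 + ia c2 * ic c1)))).
Proof.
move=> era eia erb eib erc eic; rewrite /nsq !sum_components.
have [[-> -> -> ->] [-> -> -> ->]] := symbol_realE m zeta a b c.
rewrite !era !eia !erb !eib !erc !eic.
ring.
Qed.

(** Real part of the pairing of the eigenvalue equation with gamma0 a. *)
Lemma bar_eigen m zeta lam a : symbol m zeta a 0 0 = lam%:C *: a ->
  lam * bar a = m * nsq a.
Proof.
move=> h.
have rl j : re (lam%:C *: a) j = lam * re a j.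
  by rewrite /re mxE; have [_ _ -> _] := ReImE lam 0 (a j 0).
have il j : im (lam%:C *: a) j = lam * im a j.
  by rewrite /im mxE; have [_ _ _ ->] := ReImE lam 0 (a j 0).
have re0 j : re 0 j = 0 by rewrite /re mxE.
have im0 j : im 0 j = 0 by rewrite /im mxE.
have := symbol_realE m zeta a 0 0; rewrite /= h !rl !il !re0 !im0.
move=> [[e1 e2 e3 e4] [f1 f2 f3 f4]].
rewrite barE /nsq !sum_components !mulrBr !mulrDr !expr2 !mulrA e1 e2 e3 e4 f1 f2 f3 f4.
ring.
Qed.

Lemma sqrD_le (t x y : R) : 0 < t ->
  (x + y) ^+ 2 <= (1 + t) * x ^+ 2 + (1 + t^-1) * y ^+ 2.
Proof.
move=> t0; rewrite -subr_ge0.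
suff -> : (1 + t) * x ^+ 2 + (1 + t^-1) * y ^+ 2 - (x + y) ^+ 2 =
          t * (x - t^-1 * y) ^+ 2 by rewrite mulr_ge0 ?sqr_ge0 ?ltW.
by field; rewrite gt_eqF.
Qed.

Lemma nsqD_le t a b : 0 < t ->
  nsq (a + b) <= (1 + t) * nsq a + (1 + t^-1) * nsq b.
Proof.
move=> t0; rewrite /nsq !mulr_sumr -big_split/=; apply: ler_sum => j _.
have reD : re (a + b) j = re a j + re b j by rewrite /re mxE raddfD.
have imD : im (a + b) j = im a j + im b j by rewrite /im mxE raddfD.
have key x y := sqrD_le t x y t0.
have := key (re a j) (re b j); have := key (im a j) (im b j).
rewrite reD imD; lra.
Qed.

Lemma nsqZ (x : R) a : nsq (x%:C *: a) = x ^+ 2 * nsq a.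
Proof.
rewrite /nsq mulr_sumr; apply: eq_bigr => j _.
rewrite /re /im mxE; have [_ _ -> ->] := ReImE x 0 (a j 0); ring.
Qed.

Lemma symbolB m zeta a b c a' b' c' :
  symbol m zeta (a - a') (b - b') (c - c') =
  symbol m zeta a b c - symbol m zeta a' b' c'.
Proof.
rewrite /symbol !mulmxBr.
move: (gamma0 R *m gamma1 R *m b) (gamma0 R *m gamma1 R *m b')
  (gamma0 R *m gamma2 R *m c) (gamma0 R *m gamma2 R *m c')
  (gamma0 R *m gamma3 R *m a) (gamma0 R *m gamma3 R *m a')
  (gamma0 R *m a) (gamma0 R *m a') (- 'i : R[i]) => A A' B B' C C' D D' x.
by apply/matrixP => i j; rewrite !mxE; ring.
Qed.

Lemma nsq_symbol_le m zeta a b c :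
  nsq (symbol m zeta a b c) <=
  4 * (nsq b + nsq c + (zeta ^+ 2 + m ^+ 2) * nsq a).
Proof.
rewrite /nsq !sum_components.
have [[-> -> -> ->] [-> -> -> ->]] := symbol_realE m zeta a b c.
have key (x y z t : R) : (x + y + z + t) ^+ 2 <= 4 * (x ^+ 2 + y ^+ 2 + z ^+ 2 + t ^+ 2).
  rewrite -subr_ge0.
  suff -> : 4 * (x ^+ 2 + y ^+ 2 + z ^+ 2 + t ^+ 2) - (x + y + z + t) ^+ 2 =
    (x - y) ^+ 2 + (x - z) ^+ 2 + (x - t) ^+ 2 + (y - z) ^+ 2 + (y - t) ^+ 2 + (z - t) ^+ 2.
    by rewrite !addr_ge0 ?sqr_ge0.
  ring.
have k1 := key (im b c4) (- re c c4) (zeta * re a c3) (m * re a c1).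
have k2 := key (im b c3) (re c c3) (- (zeta * re a c4)) (m * re a c2).
have k3 := key (im b c2) (- re c c2) (zeta * re a c1) (- (m * re a c3)).
have k4 := key (im b c1) (re c c1) (- (zeta * re a c2)) (- (m * re a c4)).
have k5 := key (- re b c4) (- im c c4) (zeta * im a c3) (m * im a c1).
have k6 := key (- re b c3) (im c c3) (- (zeta * im a c4)) (m * im a c2).
have k7 := key (- re b c2) (- im c c2) (zeta * im a c1) (- (m * im a c3)).
have k8 := key (- re b c1) (im c c1) (- (zeta * im a c2)) (- (m * im a c4)).
move: (lerD (lerD (lerD k1 k2) (lerD k3 k4)) (lerD (lerD k5 k6) (lerD k7 k8))).
rewrite !sqrrN !exprMn; lra.
Qed.

(** Young's inequality with weight t on the cross terms; the extra nsq b
    accounts for the two components that enter [bar] with a minus sign. *)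
Lemma bar_perturb t a b : 0 < t ->
  bar a - t * nsq a - (1 + t^-1) * nsq b <= bar (a + b).
Proof.
move=> t0; rewrite !barE /nsq !sum_components.
have reD j : re (a + b) j = re a j + re b j by rewrite /re mxE raddfD.
have imD j : im (a + b) j = im a j + im b j by rewrite /im mxE raddfD.
rewrite !reD !imD.
have key x y := sqrD_le t x y t0.
have key2 (x y : R) : x ^+ 2 - t * x ^+ 2 - (1 + t^-1) * y ^+ 2 <= (x + y) ^+ 2.
  rewrite -subr_ge0.
  suff -> : (x + y) ^+ 2 - (x ^+ 2 - t * x ^+ 2 - (1 + t^-1) * y ^+ 2) =
            t * (x + t^-1 * y) ^+ 2 + 2 * y ^+ 2.
    by apply: addr_ge0; rewrite mulr_ge0 ?sqr_ge0 ?ltW.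
  by field; rewrite gt_eqF.
move: (key2 (re a c1) (re b c1)) (key2 (im a c1) (im b c1))
  (key2 (re a c2) (re b c2)) (key2 (im a c2) (im b c2))
  (key (re a c3) (re b c3)) (key (im a c3) (im b c3))
  (key (re a c4) (re b c4)) (key (im a c4) (im b c4)).
lra.
Qed.

Lemma nsqD2 (a b : spinor R) : nsq (a + b) <= 2 * nsq a + 2 * nsq b.
Proof. by have := nsqD_le 1 a b ltr01; rewrite invr1. Qed.

Lemma spinor_ext (a b : spinor R) :
  (forall j, re a j = re b j /\ im a j = im b j) -> a = b.
Proof.
move=> ab; apply/matrixP => j k; rewrite (ord1 k); apply/eqP; rewrite eq_complex.
by have [r i] := ab j; apply/andP; split; apply/eqP.
Qed.

Lemma nsqN (a : spinor R) : nsq (- a) = nsq a.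
Proof.
apply: eq_bigr => j _; have -> : re (- a) j = - re a j by rewrite /re mxE raddfN.
have -> : im (- a) j = - im a j by rewrite /im mxE raddfN.
by rewrite !sqrrN.
Qed.

Lemma nsq_eq0 (a : spinor R) : nsq a = 0 -> a = 0.
Proof.
move=> /eqP; rewrite psumr_eq0 => [/allP h|j _]; last by rewrite addr_ge0 ?sqr_ge0.
apply: spinor_ext => j.
have /= := h j (mem_index_enum j); rewrite paddr_eq0 ?sqr_ge0// !sqrf_eq0.
by move=> /andP[/eqP -> /eqP ->]; rewrite /re /im mxE.
Qed.

Lemma re_sqr_le (a : spinor R) j : re a j ^+ 2 <= nsq a.
Proof.
rewrite /nsq (bigD1 j)//= -addrA lerDl addr_ge0 ?sqr_ge0//.
by apply: sumr_ge0 => i _; rewrite addr_ge0 ?sqr_ge0.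
Qed.

Lemma im_sqr_le (a : spinor R) j : im a j ^+ 2 <= nsq a.
Proof.
rewrite /nsq (bigD1 j)//= addrAC lerDr addr_ge0 ?sqr_ge0//.
by apply: sumr_ge0 => i _; rewrite addr_ge0 ?sqr_ge0.
Qed.

End algebra.

(** * The torus measure as a product of circle measures *)

Section plane.
Context {R : realType}.
Notation mR := (measurableTypeR R).

(** The product sigma-algebra contains the open sets because the plane is second
    countable: an open set is the union of the rational rectangles in it. *)
Lemma open_plane_measurable (U : set (R * R)) :
  open U -> measurable (U : set (mR * mR)).
Proof.
move=> oU.
pose rect (q : (rat * rat) * (rat * rat)) : set (mR * mR) :=
  `]ratr q.1.1, ratr q.1.2[%classic `*` `]ratr q.2.1, ratr q.2.2[%classic.
have -> : U = \bigcup_(q : (rat * rat) * (rat * rat))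
    (if `[< rect q `<=` U >] then rect q else set0).
  apply/seteqP; split=> [[x y] Uxy|z [q _]]; last by case: asboolP => // qU /qU.
  move: oU; rewrite openE => /(_ _ Uxy)/nbhs_ballP[_/posnumP[e] eU].
  have lte (z : R) : z - e%:num < z by rewrite ltrBlDr ltrDl.
  have gte (z : R) : z < z + e%:num by rewrite ltrDl.
  have /rat_in_itvoo[a /itvP xa] := lte x; have /rat_in_itvoo[b /itvP xb] := gte x.
  have /rat_in_itvoo[c /itvP yc] := lte y; have /rat_in_itvoo[d /itvP yd] := gte y.
  exists ((a, b), (c, d)) => //; case: asboolP => [_|].
    by rewrite /rect; split; rewrite /= in_itv/= ?xa ?xb ?yc ?yd.
  case=> -[x' y'] [/=]; rewrite !in_itv/= => /andP[ax xb'] /andP[cy yd'].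
  apply: eU; split; rewrite /ball/= ltr_distlC ?(lt_trans _ ax) ?(lt_trans _ cy) ?xa ?yc //=.
    by rewrite (lt_trans xb') // xb.
  by rewrite (lt_trans yd') // yd.
apply: countable_bigcupT_measurable => // q.
by case: ifPn => // _; apply: measurableX; exact: measurable_itv.
Qed.

Lemma continuous_plane_measurable (f : R * R -> R) : continuous f ->
  measurable_fun setT (f : mR * mR -> mR).
Proof.
move=> /continuousP cf; apply: (measurability _ (RGenOpens.measurableE R)).
move=> _ [_ [a [b ->] <-]]; rewrite setTI.
by apply: open_plane_measurable; exact/cf/interval_open.
Qed.


Lemma measurable_arc (l : R) : measurable (`[0, l[%classic : set mR).
Proof. exact: measurable_itv. Qed.

Lemma circle_fin (l : R) : (@lebesgue_measure R `[0%R, l[%classic < +oo)%E.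
Proof.
rewrite lebesgue_measure_itv/= lte_fin; case: ifP => _ //.
by rewrite oppr0 adde0 ltry.
Qed.

(** Lebesgue measure on one period.  Writing [torus_measure] as a product of
    two such measures makes the Fubini theorems apply on the torus. *)
Definition circle (l : R) : {finite_measure set mR -> \bar R} :=
  mfrestr (measurable_arc l) (circle_fin l).

Lemma integral_circle (l : R) (f : mR -> \bar R) : measurable_fun setT f ->
  (\int[circle l]_x f x = \int[lebesgue_measure]_(x in `[0%R, l[) f x)%E.
Proof.
move=> mf; transitivity (\int[circle l]_(x in `[0%R, l[) f x)%E.
  rewrite [RHS]integral_mkcond.
  have mN : measurable (~` `[0, l[%classic : set mR).
    by apply: measurableC; exact: measurable_arc.
  have mfl : measurable_fun (`[0, l[%classic : set mR) f.
    exact: measurable_funTS mf.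
  have mfr := (measurable_restrictT _ (measurable_arc l)).1 mfl.
  apply: ae_eq_integral mfr _ => //.
  exists (~` `[0, l[%classic); split => //.
    by rewrite /circle /= /mfrestr /mrestr setICl measure0.
  move=> x /= h xl; apply: h => _; rewrite patchE.
  by rewrite mem_set.
apply: eq_measure_integral => A mA /setIidl AI.
by rewrite /circle /= /mfrestr /mrestr AI.
Qed.

Lemma torus_measureE (l1 l2 : R) (A : set (mR * mR)) : measurable A ->
  torus_measure l1 l2 A = (circle l1 \x circle l2)%E A.
Proof.
move=> mA; apply/esym/(product_measure_unique (m' := torus_measure l1 l2)) => //.
move=> B C mB mC; rewrite /torus_measure /= /mrestr /cell -setXI product_measure1E//.
- exact: measurableI.
- exact: measurableI.
Qed.

Lemma torus_integralE (l1 l2 : R) (f : mR * mR -> \bar R) :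
  (\int[torus_measure l1 l2]_x f x = \int[circle l1 \x circle l2]_x f x)%E.
Proof. by apply: eq_measure_integral => A mA _; exact: torus_measureE. Qed.

End plane.

(** * Functions of one variable and slices of functions on the plane *)

Section line.
Context {R : realType}.
Notation mR := (measurableTypeR R).
Variables (g dg : R -> R).
Hypothesis gdg : forall x : R, is_derive x 1 g (dg x).
Hypothesis cdg : continuous dg.

Lemma derivable_line (x : R) : derivable g x 1.
Proof. by have [] := gdg x. Qed.

Lemma continuous_line : continuous g.
Proof.
move=> x; apply: differentiable_continuous.
by apply/derivable1_diffP; exact: derivable_line.
Qed.

Lemma FTC_line (a b : R) : a < b ->
  (\int[lebesgue_measure]_(x in `[a, b]) (dg x)%:E = (g b)%:E - (g a)%:E)%E.
Proof.
move=> ab; apply: continuous_FTC2 => //.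
- exact: continuous_subspaceT.
- split; first by move=> x _; exact: derivable_line.
  + by apply: cvg_at_right_filter; exact: continuous_line.
  + by apply: cvg_at_left_filter; exact: continuous_line.
- by move=> x _; rewrite derive1E; have [_ ->] := gdg x.
Qed.

Lemma measurable_line : measurable_fun setT (EFin \o dg : mR -> \bar R).
Proof. by apply/measurable_EFinP; exact: continuous_measurable_fun. Qed.

Lemma FTC_circle (l : R) : 0 < l ->
  (\int[circle l]_x (dg x)%:E = (g l - g 0)%:E)%E.
Proof.
move=> l0; rewrite integral_circle; last exact: measurable_line.
rewrite integral_itv_bndo_bndc ?FTC_line//.
exact: measurable_funTS measurable_line.
Qed.

(** The oscillation of a C^1 function over one period is at most the integral of
    its derivative. *)
Lemma variation_circle (l x y : R) : 0 <= x < l -> 0 <= y < l ->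
  (`|g x - g y|%:E <= \int[circle l]_s `|dg s|%:E)%E.
Proof.
wlog xy : x y / x < y.
  move=> h hx hy; have [xy|yx|->] := ltgtP x y; first exact: h.
    by rewrite distrC; exact: h.
  by rewrite subrr normr0; apply: integral_ge0 => s _; rewrite lee_fin.
move=> /andP[x0 xl] /andP[y0 yl].
have mabs : measurable_fun setT ((fun s => `|dg s|%:E) : mR -> \bar R).
  by apply/measurable_EFinP; apply: measurableT_comp => //; exact: continuous_measurable_fun.
rewrite integral_circle// distrC.
have -> : (`|g y - g x|%:E = `|(g y)%:E - (g x)%:E|)%E by [].
rewrite -FTC_line//.
apply: (le_trans (le_abse_integral _ _ _)) => //.
  exact: measurable_funTS measurable_line.
apply: ge0_subset_integral => //=.
- exact: measurable_funTS mabs.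
- by move=> s; rewrite /= !in_itv/= => /andP[xs sy]; rewrite (le_trans x0)// (le_lt_trans sy).
Qed.

End line.

Section slices.
Context {R : realType}.
Implicit Types f : R * R -> R.

Lemma slice1 f (x y : R) : differentiable f (x, y) ->
  is_derive x 1 (fun t => f (t, y)) ('D_(e1 R) f (x, y)).
Proof.
move=> /(@diff_derivable _ _ _ _ _ (e1 R)) df.
have E : (fun h : R => h^-1 *: (f (h *: 1 + x, y) - f (x, y))) =
         (fun h : R => h^-1 *: ((f \o shift (x, y)) (h *: e1 R) - f (x, y))).
  apply/funext => h /=; congr (_ *: (f _ - _)).
  by rewrite /e1; congr pair; rewrite /= ?scaler0 ?add0r.
by apply: DeriveDef; rewrite /derivable /derive /= E.
Qed.

Lemma slice2 f (x y : R) : differentiable f (x, y) ->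
  is_derive y 1 (fun t => f (x, t)) ('D_(e2 R) f (x, y)).
Proof.
move=> /(@diff_derivable _ _ _ _ _ (e2 R)) df.
have E : (fun h : R => h^-1 *: (f (x, h *: 1 + y) - f (x, y))) =
         (fun h : R => h^-1 *: ((f \o shift (x, y)) (h *: e2 R) - f (x, y))).
  apply/funext => h /=; congr (_ *: (f _ - _)).
  by rewrite /e2; congr pair; rewrite /= ?scaler0 ?add0r.
by apply: DeriveDef; rewrite /derivable /derive /= E.
Qed.

Lemma continuous_slice1 f (y : R) : continuous f -> continuous (fun t => f (t, y)).
Proof.
move=> cf x; have cp : (fun t : R => (t, y)) @ x --> (x, y).
  by apply: (@cvg_pair _ _ _ (nbhs x) (nbhs x) (nbhs y) _ _ _ id (cst y));
    [exact: cvg_id|exact: cvg_cst].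
exact: (cvg_comp _ _ cp (cf (x, y))).
Qed.

Lemma continuous_slice2 f (x : R) : continuous f -> continuous (fun t => f (x, t)).
Proof.
move=> cf y; have cp : (fun t : R => (x, t)) @ y --> (x, y).
  by apply: (@cvg_pair _ _ _ (nbhs y) (nbhs x) (nbhs y) _ _ _ (cst x) id);
    [exact: cvg_cst|exact: cvg_id].
exact: (cvg_comp _ _ cp (cf (x, y))).
Qed.

End slices.

(** * Symmetry of second derivatives *)

Section clairaut.
Context {R : realType}.
Implicit Types f : R * R -> R.

Lemma dist_middle (p q w e : R) : `|p - w| < e / 2 -> `|q - w| < e / 2 ->
  `|p - q| <= e.
Proof.
move=> pw qw; rewrite (le_trans (ler_distD w _ _))// (splitr e).
by rewrite (distrC w) ltW// ltrD.
Qed.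

Lemma mean_value (g dg : R -> R) (a h : R) : 0 < h ->
  (forall x : R, is_derive x 1 g (dg x)) ->
  exists2 c, a < c < a + h & g (a + h) - g a = dg c * h.
Proof.
move=> h0 gdg; have ah : a < a + h by rewrite ltrDl.
have [] := MVT ah (fun x _ => gdg x).
  by apply: derivable_within_continuous => x _; have [] := gdg x.
by move=> c; rewrite in_itv/= => ac ->; exists c => //; rewrite addrC addKr.
Qed.

Lemma second_difference12 f (a b h : R) : 0 < h ->
  (forall x, differentiable f x) -> (forall x, differentiable ('D_(e1 R) f) x) ->
  exists xi : R * R, [/\ a < xi.1 < a + h, b < xi.2 < b + h &
    f (a + h, b + h) - f (a + h, b) - (f (a, b + h) - f (a, b)) =
    'D_(e2 R) ('D_(e1 R) f) xi * h * h].
Proof.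
move=> h0 df d1f.
have [c ac E] := mean_value (fun t => f (t, b + h) - f (t, b)) _ a h h0
  (fun t => is_deriveB (slice1 _ _ _ (df (t, b + h))) (slice1 _ _ _ (df (t, b)))).
have [d bd F] := mean_value (fun t => 'D_(e1 R) f (c, t)) _ b h h0
  (fun t => slice2 _ _ _ (d1f (c, t))).
by exists (c, d); split => //; rewrite E F.
Qed.

Lemma second_difference21 f (a b h : R) : 0 < h ->
  (forall x, differentiable f x) -> (forall x, differentiable ('D_(e2 R) f) x) ->
  exists xi : R * R, [/\ a < xi.1 < a + h, b < xi.2 < b + h &
    f (a + h, b + h) - f (a + h, b) - (f (a, b + h) - f (a, b)) =
    'D_(e1 R) ('D_(e2 R) f) xi * h * h].
Proof.
move=> h0 df d2f.
have [d bd E] := mean_value (fun t => f (a + h, t) - f (a, t)) _ b h h0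
  (fun t => is_deriveB (slice2 _ _ _ (df (a + h, t))) (slice2 _ _ _ (df (a, t)))).
have [c ac F] := mean_value (fun t => 'D_(e2 R) f (t, d)) _ a h h0
  (fun t => slice1 _ _ _ (d2f (t, d))).
exists (c, d); split => //; move: E; rewrite F => <-; ring.
Qed.

(** Both iterated mean value theorems express the same second difference over a
    square of side h, so the two mixed derivatives agree at points within h of
    (a, b); continuity lets h tend to 0. *)
Lemma clairaut f : (forall x, differentiable f x) ->
  (forall x, differentiable ('D_(e1 R) f) x) ->
  (forall x, differentiable ('D_(e2 R) f) x) ->
  continuous ('D_(e2 R) ('D_(e1 R) f)) -> continuous ('D_(e1 R) ('D_(e2 R) f)) ->
  'D_(e2 R) ('D_(e1 R) f) = 'D_(e1 R) ('D_(e2 R) f).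
Proof.
move=> df d1f d2f c12 c21; apply/funext => -[a b].
apply/eqP; rewrite -subr_eq0 -normr_le0; apply/ler_addgt0Pl => e e0.
rewrite addr0.
have e20 : 0 < e / 2 by rewrite divr_gt0.
have /cvgrPdist_lt/(_ _ e20)/nbhs_ballP[r1 /= r10 B1] := c12 (a, b).
have /cvgrPdist_lt/(_ _ e20)/nbhs_ballP[r2 /= r20 B2] := c21 (a, b).
pose h := Num.min r1 r2; have h0 : 0 < h by rewrite lt_min r10.
have hr1 : h <= r1 by rewrite /h ge_min lexx.
have hr2 : h <= r2 by rewrite /h ge_min lexx orbT.
have near (r : R) (xi : R * R) : h <= r -> a < xi.1 < a + h -> b < xi.2 < b + h ->
    ball (a, b) r xi.
  move=> hr /andP[a1 a2] /andP[b1 b2]; split; rewrite /ball/= ltr_distlC.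
    by rewrite (lt_trans _ a1) ?ltrBlDr ?ltrDl ?(lt_le_trans h0)//= (lt_le_trans a2)// lerD2l.
  by rewrite (lt_trans _ b1) ?ltrBlDr ?ltrDl ?(lt_le_trans h0)//= (lt_le_trans b2)// lerD2l.
have [x [x1 x2 xE]] := second_difference12 f a b h h0 df d1f.
have [y [y1 y2 yE]] := second_difference21 f a b h h0 df d2f.
have xy : 'D_(e2 R) ('D_(e1 R) f) x = 'D_(e1 R) ('D_(e2 R) f) y.
  apply: (mulIf (lt0r_neq0 h0)); apply: (mulIf (lt0r_neq0 h0)).
  exact: etrans (esym xE) yE.
have k1 : `|'D_(e2 R) ('D_(e1 R) f) (a, b) - 'D_(e2 R) ('D_(e1 R) f) x| < e / 2.
  exact: (B1 _ (near r1 x hr1 x1 x2)).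
have k2 : `|'D_(e1 R) ('D_(e2 R) f) (a, b) - 'D_(e1 R) ('D_(e2 R) f) y| < e / 2.
  exact: (B2 _ (near r2 y hr2 y1 y2)).
by rewrite -xy in k2; exact: dist_middle k1 k2.
Qed.

End clairaut.

(** * Divergences integrate to zero on the torus *)

Section torus.
Context {R : realType} (l1 l2 : R).
Hypotheses (hl1 : 0 < l1) (hl2 : 0 < l2).
Notation mR := (measurableTypeR R).
Notation mu := (torus_measure l1 l2).
Implicit Types f g h : R * R -> R.

Lemma circle_setT (l : R) : 0 < l -> circle l setT = l%:E.
Proof.
move=> l0; rewrite /circle /= /mfrestr /mrestr setTI.
by rewrite lebesgue_measure_itv/= lte_fin l0 oppr0 adde0.
Qed.

Lemma torus_setT : mu setT = (l1 * l2)%:E.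
Proof.
rewrite torus_measureE; last exact: measurableT.
rewrite -setXTT product_measure1E; [|exact: measurableT|exact: measurableT].
transitivity (circle l1 setT * circle l2 setT)%E; first by [].
by rewrite !circle_setT.
Qed.

Lemma ae_cell : {ae mu, forall x, cell l1 l2 x}.
Proof.
exists (~` cell l1 l2); split => //.
  by apply: measurableC; exact: measurable_cell.
by rewrite /torus_measure /= /mrestr setICl measure0.
Qed.

Lemma continuous_bounded_cell f : continuous f ->
  exists2 M : R, 0 <= M & forall x, cell l1 l2 x -> `|f x| <= M.
Proof.
move=> cf.
have K : compact (`[0, l1]%classic `*` `[0, l2]%classic : set (R * R)).
  by apply: compact_setX; exact: segment_compact.
have /compact_bounded[M [_ hM]] := continuous_compact (continuous_subspaceT cf) K.
exists (`|M| + 1) => [|[x y] [/=]]; first by rewrite addr_ge0.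
rewrite !in_itv/= => /andP[x0 x1] /andP[y0 y1].
apply: (hM (`|M| + 1)); first by rewrite ltr_pwDr// ler_norm.
by exists (x, y) => //; split; rewrite /= in_itv/= ?x0 ?y0 ltW.
Qed.

Lemma measurable_plane_EFin f : continuous f ->
  measurable_fun setT (EFin \o f : mR * mR -> \bar R).
Proof. by move=> cf; apply/measurable_EFinP; exact: continuous_plane_measurable. Qed.

Lemma continuous_torus_integrable f : continuous f ->
  mu.-integrable setT (EFin \o f : mR * mR -> \bar R).
Proof.
move=> cf; have mf := measurable_plane_EFin f cf.
have [M M0 hM] := continuous_bounded_cell f cf.
apply/integrableP; split => //.
apply: (@le_lt_trans _ _ (M%:E * mu setT)%E); last by rewrite torus_setT -EFinM ltry.
apply: integral_le_bound => //.
by apply: filterS ae_cell => x xc _; rewrite lee_fin; exact: hM.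
Qed.

Lemma continuous_prod_integrable f : continuous f ->
  (circle l1 \x circle l2)%E.-integrable setT (EFin \o f : mR * mR -> \bar R).
Proof.
move=> cf; have /integrableP[mf] := continuous_torus_integrable f cf.
by rewrite torus_integralE => foo; apply/integrableP; split.
Qed.

(** Continuity is kept with the vanishing of the integral: it provides the
    integrability needed for linear combinations. *)
Definition torus_null h := continuous h /\ (\int[mu]_x (h x)%:E = 0)%E.

Lemma torus_nullD f g : torus_null f -> torus_null g -> torus_null (f \+ g).
Proof.
move=> [cf f0] [cg g0]; split.
  by move=> x; apply: (@continuousD _ _ _ f g); [exact: cf|exact: cg].
under eq_integral do rewrite EFinD.
rewrite integralD//; first by rewrite f0 g0 adde0.
- exact: continuous_torus_integrable.
- exact: continuous_torus_integrable.
Qed.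

Lemma torus_nullZ (a : R) f : torus_null f -> torus_null (fun x => a * f x).
Proof.
move=> [cf f0]; split.
  by move=> x; apply: (@continuousM _ _ (cst a) f); [exact: cst_continuous|exact: cf].
under eq_integral do rewrite EFinM.
by rewrite integralZl// ?f0 ?mule0//; exact: continuous_torus_integrable.
Qed.

Lemma torus_nullB f g : torus_null f -> torus_null g -> torus_null (fun x => f x - g x).
Proof.
move=> nf ng; have := torus_nullD _ _ nf (torus_nullZ (-1) _ ng).
by congr torus_null; apply/funext => x /=; rewrite mulN1r.
Qed.

Definition torus_periodic h :=
  forall x : R * R, h (x.1 + l1, x.2) = h x /\ h (x.1, x.2 + l2) = h x.

(** Fubini: the inner integral over one period telescopes by periodicity. *)
Lemma torus_null_D1 h : (forall x, differentiable h x) -> torus_periodic h ->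
  continuous ('D_(e1 R) h) -> torus_null ('D_(e1 R) h).
Proof.
move=> dh ph ch; split => //.
rewrite torus_integralE -(integral21_prod_meas1 (continuous_prod_integrable _ ch)).
apply: integral0_eq => y _; rewrite /fubini_G /=.
have dsl : forall x : R, is_derive x 1 (fun t => h (t, y)) ('D_(e1 R) h (x, y)).
  by move=> x; exact: slice1.
rewrite (FTC_circle _ _ dsl (continuous_slice1 _ y ch) _ hl1).
by have [+ _] := ph (0, y); rewrite /= add0r => ->; rewrite subrr.
Qed.

Lemma torus_null_D2 h : (forall x, differentiable h x) -> torus_periodic h ->
  continuous ('D_(e2 R) h) -> torus_null ('D_(e2 R) h).
Proof.
move=> dh ph ch; split => //.
rewrite torus_integralE -(integral12_prod_meas1 (continuous_prod_integrable _ ch)).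
apply: integral0_eq => x _; rewrite /fubini_F /=.
have dsl : forall y : R, is_derive y 1 (fun t => h (x, t)) ('D_(e2 R) h (x, y)).
  by move=> y; exact: slice2.
rewrite (FTC_circle _ _ dsl (continuous_slice2 _ x ch) _ hl2).
by have [_ +] := ph (x, 0); rewrite /= add0r => ->; rewrite subrr.
Qed.

Lemma smooth_differentiable h : smooth h -> forall x, differentiable h x.
Proof. by move=> /(_ 1%N)[]. Qed.

Lemma smooth_continuous h : smooth h -> continuous h.
Proof. by move=> /(_ 0%N). Qed.

Lemma smooth_D1 h : smooth h -> smooth ('D_(e1 R) h).
Proof. by move=> sh n; have [] := sh n.+1. Qed.

Lemma smooth_D2 h : smooth h -> smooth ('D_(e2 R) h).
Proof. by move=> sh n; have [] := sh n.+1. Qed.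

Lemma periodic_derive h v : torus_periodic h -> torus_periodic ('D_v h).
Proof.
move=> ph [x y]; split => /=; rewrite /derive; do 2 f_equal; apply/funext => t /=.
  have [-> _] := ph (x, y); congr (_ *: (_ - _)).
  have [<- _] := ph (t *: v + (x, y)); congr h.
  by rewrite /=; congr pair; rewrite addrA.
have [_ ->] := ph (x, y); congr (_ *: (_ - _)).
have [_ <-] := ph (t *: v + (x, y)); congr h.
by rewrite /=; congr pair; rewrite addrA.
Qed.

Definition smooth_periodic h := smooth h /\ torus_periodic h.

Lemma smooth_periodic_D1 h : smooth_periodic h -> smooth_periodic ('D_(e1 R) h).
Proof. by move=> [sh ph]; split; [exact: smooth_D1|exact: periodic_derive]. Qed.

Lemma smooth_periodic_D2 h : smooth_periodic h -> smooth_periodic ('D_(e2 R) h).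
Proof. by move=> [sh ph]; split; [exact: smooth_D2|exact: periodic_derive]. Qed.

Lemma continuous_mul f g : continuous f -> continuous g -> continuous (f * g).
Proof. by move=> cf cg x; apply: (@continuousM _ _ f g); [exact: cf|exact: cg]. Qed.

Lemma continuous_add f g : continuous f -> continuous g -> continuous (f + g).
Proof. by move=> cf cg x; apply: (@continuousD _ _ _ f g); [exact: cf|exact: cg]. Qed.

Lemma derive_mul f g v : (forall x, differentiable f x) ->
  (forall x, differentiable g x) ->
  'D_v (f * g) = 'D_v f * g + f * 'D_v g.
Proof.
move=> df dg; apply/funext => x.
rewrite deriveM; [|exact: diff_derivable|exact: diff_derivable].
by rewrite addrC; congr (_ + _); exact: mulrC.
Qed.

Lemma periodic_mul f g : torus_periodic f -> torus_periodic g ->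
  torus_periodic (f * g).
Proof.
move=> pf pg x; have [a b] := pf x; have [c d] := pg x.
have E z : (f * g) z = f z * g z by [].
by rewrite !E a b c d.
Qed.

Lemma torus_ibp1 f g : smooth_periodic f -> smooth_periodic g ->
  torus_null (fun x => 'D_(e1 R) f x * g x + f x * 'D_(e1 R) g x).
Proof.
move=> [sf pf] [sg pg].
have df := smooth_differentiable _ sf; have dg := smooth_differentiable _ sg.
have E := derive_mul _ _ (e1 R) df dg.
have := @torus_null_D1 (f * g); rewrite E; apply.
- by move=> x; exact: differentiableM.
- exact: periodic_mul.
- apply: continuous_add; apply: continuous_mul; apply: smooth_continuous => //;
    exact: smooth_D1.
Qed.

Lemma torus_ibp2 f g : smooth_periodic f -> smooth_periodic g ->
  torus_null (fun x => 'D_(e2 R) f x * g x + f x * 'D_(e2 R) g x).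
Proof.
move=> [sf pf] [sg pg].
have df := smooth_differentiable _ sf; have dg := smooth_differentiable _ sg.
have E := derive_mul _ _ (e2 R) df dg.
have := @torus_null_D2 (f * g); rewrite E; apply.
- by move=> x; exact: differentiableM.
- exact: periodic_mul.
- apply: continuous_add; apply: continuous_mul; apply: smooth_continuous => //;
    exact: smooth_D2.
Qed.

(** d1 f d2 g - d1 g d2 f = d1 (f d2 g) - d2 (f d1 g), by symmetry of the second
    derivatives. *)
Lemma torus_null_jacobian f g : smooth_periodic f -> smooth_periodic g ->
  torus_null (fun x => 'D_(e1 R) f x * 'D_(e2 R) g x - 'D_(e1 R) g x * 'D_(e2 R) f x).
Proof.
move=> sf sg.
have n1 := torus_ibp1 _ _ sf (smooth_periodic_D2 _ sg).
have n2 := torus_ibp2 _ _ sf (smooth_periodic_D1 _ sg).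
have := torus_nullB _ _ n1 n2; congr torus_null; apply/funext => x.
have -> : 'D_(e2 R) ('D_(e1 R) g) x = 'D_(e1 R) ('D_(e2 R) g) x.
  have [{}sg _] := sg; have s1 := smooth_D1 _ sg; have s2 := smooth_D2 _ sg.
  have cl : 'D_(e2 R) ('D_(e1 R) g) = 'D_(e1 R) ('D_(e2 R) g).
    apply: clairaut; [exact: smooth_differentiable|exact: smooth_differentiable|
      exact: smooth_differentiable|exact/smooth_continuous/smooth_D2|
      exact/smooth_continuous/smooth_D1].
  exact: (congr1 (fun u => u x) cl).
by ring.
Qed.

End torus.

(** * The energy identity for the Dirac operator *)

Section energy.
Context {R : realType} (l1 l2 : R).
Hypotheses (hl1 : 0 < l1) (hl2 : 0 < l2).
Notation mR := (measurableTypeR R).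
Notation mu := (torus_measure l1 l2).

Lemma re_partial v (u : spinor_field R) x j :
  re (partial v u x) j = 'D_v (fun y => re (u y) j) x.
Proof. by rewrite /re /partial mxE. Qed.

Lemma im_partial v (u : spinor_field R) x j :
  im (partial v u x) j = 'D_v (fun y => im (u y) j) x.
Proof. by rewrite /im /partial mxE. Qed.

Lemma continuous_nsq (u : spinor_field R) :
  (forall j, continuous (fun x => re (u x) j)) ->
  (forall j, continuous (fun x => im (u x) j)) ->
  continuous (fun x => nsq (u x)).
Proof.
move=> cr ci.
have csq j : continuous (fun x => re (u x) j ^+ 2 + im (u x) j ^+ 2).
  exact: (continuous_add _ _ (continuous_mul _ _ (cr j) (cr j))
                             (continuous_mul _ _ (ci j) (ci j))).
have -> : (fun x => nsq (u x)) =
    (fun x => re (u x) c1 ^+ 2 + im (u x) c1 ^+ 2) +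
    (fun x => re (u x) c2 ^+ 2 + im (u x) c2 ^+ 2) +
    (fun x => re (u x) c3 ^+ 2 + im (u x) c3 ^+ 2) +
    (fun x => re (u x) c4 ^+ 2 + im (u x) c4 ^+ 2).
  by apply/funext => x; rewrite /nsq sum_components.
by do 3![apply: continuous_add => //].
Qed.

(** The weak form of D^2 = - Laplacian + zeta^2 + m^2. *)
Lemma energy (m zeta : R) (u : spinor_field R) :
  Defs.periodic l1 l2 u -> smooth_field u ->
  continuous (fun x => nsq (symbol m zeta (u x) (partial (e1 R) u x) (partial (e2 R) u x))) /\
  (\int[mu]_x (nsq (symbol m zeta (u x) (partial (e1 R) u x) (partial (e2 R) u x)))%:E =
   \int[mu]_x (nsq (partial (e1 R) u x) + nsq (partial (e2 R) u x)
               + (zeta ^+ 2 + m ^+ 2) * nsq (u x))%:E)%E.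
Proof.
move=> pu su.
pose r j x := re (u x) j; pose s j x := im (u x) j.
have sr j : smooth_periodic l1 l2 (r j).
  split; first by have [] := su j.
  by move=> x; have [a b] := pu x; rewrite /r a b.
have ss j : smooth_periodic l1 l2 (s j).
  split; first by have [] := su j.
  by move=> x; have [a b] := pu x; rewrite /s a b.
have nJ j := torus_null_jacobian _ _ hl1 hl2 _ _ (sr j) (ss j).
have n1 j k := torus_nullB _ _ hl1 hl2 _ _
  (torus_ibp1 _ _ hl1 hl2 _ _ (ss j) (sr k)) (torus_ibp1 _ _ hl1 hl2 _ _ (sr j) (ss k)).
have n2 j k := torus_nullD _ _ hl1 hl2 _ _
  (torus_ibp2 _ _ hl1 hl2 _ _ (sr j) (sr k)) (torus_ibp2 _ _ hl1 hl2 _ _ (ss j) (ss k)).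
have nD := torus_nullD _ _ hl1 hl2; have nB := torus_nullB _ _ hl1 hl2.
have nZ := torus_nullZ _ _ hl1 hl2.
have [cN N0] := nB _ _ (nD _ _
  (nZ 2 _ (nB _ _ (nD _ _ (nB _ _ (nJ c4) (nJ c3)) (nJ c2)) (nJ c1)))
  (nZ 2 _ (nD _ _ (nD _ _ (nD _ _ (nZ zeta _ (n1 c4 c3)) (nZ m _ (n1 c4 c1)))
                       (nZ m _ (n1 c3 c2))) (nZ zeta _ (n1 c2 c1)))))
  (nZ 2 _ (nD _ _ (nB _ _ (nD _ _ (nZ zeta _ (n2 c4 c3)) (nZ m _ (n2 c4 c1)))
                       (nZ m _ (n2 c3 c2))) (nZ zeta _ (n2 c2 c1)))).
set N := (fun x : R * R => _) in cN N0.
set A := fun x : R * R => nsq (partial (e1 R) u x) + nsq (partial (e2 R) u x)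
               + (zeta ^+ 2 + m ^+ 2) * nsq (u x).
have cA : continuous A.
  have cr v j : smooth (fun x => 'D_v (r j) x) -> smooth (fun x => 'D_v (s j) x) ->
     continuous (fun x => re (partial v u x) j) /\ continuous (fun x => im (partial v u x) j).
    move=> s1 s2; split.
      have -> : (fun x => re (partial v u x) j) = 'D_v (r j).
        by apply/funext => x; rewrite re_partial.
      exact: smooth_continuous.
    have -> : (fun x => im (partial v u x) j) = 'D_v (s j).
      by apply/funext => x; rewrite im_partial.
    exact: smooth_continuous.
  have k1 j := cr (e1 R) j (smooth_D1 _ (sr j).1) (smooth_D1 _ (ss j).1).
  have k2 j := cr (e2 R) j (smooth_D2 _ (sr j).1) (smooth_D2 _ (ss j).1).
  apply: (continuous_add (fun x => nsq (partial (e1 R) u x) + nsq (partial (e2 R) u x))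
    (fun x => (zeta ^+ 2 + m ^+ 2) * nsq (u x))).
    apply: (continuous_add (fun x => nsq (partial (e1 R) u x))
      (fun x => nsq (partial (e2 R) u x))).
      by apply: continuous_nsq => j; have [] := k1 j.
    by apply: continuous_nsq => j; have [] := k2 j.
  apply: (continuous_mul (fun=> zeta ^+ 2 + m ^+ 2) (fun x => nsq (u x))).
    by move=> x; exact: cst_continuous.
  by apply: continuous_nsq => j; apply: smooth_continuous; [exact: (sr j).1|exact: (ss j).1].
have E : (fun x => nsq (symbol m zeta (u x) (partial (e1 R) u x) (partial (e2 R) u x)))
    = A \+ N.
  apply/funext => x.
  exact: (nsq_symbol m zeta _ _ _ (r^~ x) (s^~ x)
    (fun j => 'D_(e1 R) (r j) x) (fun j => 'D_(e1 R) (s j) x)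
    (fun j => 'D_(e2 R) (r j) x) (fun j => 'D_(e2 R) (s j) x)
    (fun=> erefl) (fun=> erefl) (re_partial _ _ _) (im_partial _ _ _)
    (re_partial _ _ _) (im_partial _ _ _)).
split; first by rewrite E; exact: (continuous_add _ _ cA cN).
transitivity (\int[mu]_x ((A x)%:E + (N x)%:E))%E.
  by apply: eq_integral => x _; rewrite -EFinD; congr EFin; exact: (congr1 (fun F => F x) E).
rewrite integralD//; [by rewrite N0 adde0| |].
- exact: continuous_torus_integrable.
- exact: continuous_torus_integrable.
Qed.

End energy.

(** * A Poincare inequality *)

Section poincare.
Context {R : realType} (l1 l2 : R).
Hypotheses (hl1 : 0 < l1) (hl2 : 0 < l2).
Notation mR := (measurableTypeR R).
Notation mu := (torus_measure l1 l2).

Lemma measurable_abs_plane (f : R * R -> R) : continuous f ->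
  measurable_fun setT ((fun x => `|f x|%:E) : mR * mR -> \bar R).
Proof.
move=> cf; apply/measurable_EFinP; apply: measurableT_comp => //.
exact: continuous_plane_measurable.
Qed.

Lemma cell_fin : ((lebesgue_measure \x lebesgue_measure) (cell l1 l2) < +oo)%E.
Proof.
have := torus_setT l1 l2 hl1 hl2.
by rewrite /torus_measure /= /mrestr setTI => ->; rewrite ltry.
Qed.

(** Convertible to [torus_measure], with the finiteness that Tonelli's theorem
    requires. *)
Definition finite_torus : {finite_measure set (mR * mR)%type -> \bar R} :=
  mfrestr (measurable_cell l1 l2) cell_fin.

Lemma measurable_integral_fst (F : (mR * mR) * (mR * mR) -> \bar R) :
  measurable_fun setT F -> (forall z, 0 <= F z)%E ->
  measurable_fun setT (fun x => \int[mu]_y F (x, y))%E.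
Proof. exact: (measurable_fun_fubini_tonelli_F (m2 := finite_torus)). Qed.

Lemma integral_fst_only (B : mR -> \bar R) : measurable_fun setT B ->
  (forall u, 0 <= B u)%E ->
  (\int[mu]_x B x.1 = l2%:E * \int[circle l1]_u B u)%E.
Proof.
move=> mB B0; rewrite torus_integralE (fubini_tonelli1 (fun x => B x.1)) //; last first.
  exact: measurableT_comp.
have cE (u : mR) : (\int[circle l2]_y B (u, y).1 = l2%:E * B u)%E.
  rewrite /= integral_cst// muleC; congr (_ * _)%E; exact: circle_setT.
rewrite /fubini_F (eq_integral _ _ (fun u _ => cE u)).
by rewrite ge0_integralZl// lee_fin ltW.
Qed.

Lemma integral_snd_only (A : mR -> \bar R) : measurable_fun setT A ->
  (forall v, 0 <= A v)%E ->
  (\int[mu]_x A x.2 = l1%:E * \int[circle l2]_v A v)%E.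
Proof.
move=> mA A0; rewrite torus_integralE (fubini_tonelli2 (fun x => A x.2)) //; last first.
  exact: measurableT_comp.
have cE (v : mR) : (\int[circle l1]_x A (x, v).2 = l1%:E * A v)%E.
  rewrite /= integral_cst// muleC; congr (_ * _)%E; exact: circle_setT.
rewrite /fubini_G (eq_integral _ _ (fun v _ => cE v)).
by rewrite ge0_integralZl// lee_fin ltW.
Qed.

(** Go from x to y along the broken line through (y.1, x.2).  The variation along
    the first piece is at most A x.2, the integral of |'D_(e1 R) f| on a
    horizontal period; along the second it is at most B y.1, the integral of
    |'D_(e2 R) f| on a vertical one.  Both are then integrated over the torus. *)
Lemma torus_poincare (f : R * R -> R) : (forall x, differentiable f x) ->
  continuous ('D_(e1 R) f) -> continuous ('D_(e2 R) f) ->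
  (\int[mu]_x \int[mu]_y `|f x - f y|%:E <=
   (l1 * l2)%:E * (l1%:E * \int[mu]_x `|'D_(e1 R) f x|%:E
                   + l2%:E * \int[mu]_x `|'D_(e2 R) f x|%:E))%E.
Proof.
move=> df c1f c2f.
have cf : continuous f by move=> x; exact: differentiable_continuous.
pose F1 : mR * mR -> \bar R := fun z => `|'D_(e1 R) f z|%:E.
pose F2 : mR * mR -> \bar R := fun z => `|'D_(e2 R) f z|%:E.
have m1 : measurable_fun setT F1 := measurable_abs_plane _ c1f.
have m2 : measurable_fun setT F2 := measurable_abs_plane _ c2f.
have F10 z : (0 <= F1 z)%E by rewrite lee_fin.
have F20 z : (0 <= F2 z)%E by rewrite lee_fin.
pose A (v : mR) := (\int[circle l1]_s F1 (s, v))%E.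
pose B (u : mR) := (\int[circle l2]_t F2 (u, t))%E.
have mA : measurable_fun setT A.
  exact: (measurable_fun_fubini_tonelli_G (m1 := circle l1) F1 m1 F10).
have mB : measurable_fun setT B.
  exact: (measurable_fun_fubini_tonelli_F (m2 := circle l2) F2 m2 F20).
have A0 v : (0 <= A v)%E by apply: integral_ge0 => s _; exact: F10.
have B0 v : (0 <= B v)%E by apply: integral_ge0 => s _; exact: F20.
have EA : (\int[mu]_x A x.2 = l1%:E * \int[mu]_x F1 x)%E.
  rewrite [X in (_ * X)%E]torus_integralE (fubini_tonelli2 F1 m1 F10).
  exact: integral_snd_only mA A0.
have EB : (\int[mu]_x B x.1 = l2%:E * \int[mu]_x F2 x)%E.
  rewrite [X in (_ * X)%E]torus_integralE (fubini_tonelli1 F2 m2 F20).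
  exact: integral_fst_only mB B0.
change (\int[mu]_x \int[mu]_y `|f x - f y|%:E <=
   (l1 * l2)%:E * (l1%:E * \int[mu]_x F1 x + l2%:E * \int[mu]_x F2 x))%E.
have T0 : (0 <= (l1 * l2)%:E)%E by rewrite lee_fin mulr_ge0// ltW.
have mF : measurable_fun setT
   ((fun z => `|f z.1 - f z.2|%:E) : (mR * mR) * (mR * mR) -> \bar R).
  apply/measurable_EFinP; apply: measurableT_comp => //.
  have mf := continuous_plane_measurable f cf.
  by apply: measurable_funB; exact: measurableT_comp.
have pt x y : cell l1 l2 x -> cell l1 l2 y -> (`|f x - f y|%:E <= A x.2 + B y.1)%E.
  case: x y => [x1 x2] [y1 y2] [/=]; rewrite !in_itv/= => hx1 hx2 [/=].
  rewrite !in_itv/= => hy1 hy2.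
  apply: (@le_trans _ _ (`|f (x1, x2) - f (y1, x2)| + `|f (y1, x2) - f (y1, y2)|)%:E).
    by rewrite lee_fin ler_distD.
  rewrite EFinD; apply: leeD.
    exact: (variation_circle _ _ (fun s => slice1 _ _ _ (df (s, x2)))
      (continuous_slice1 _ x2 c1f)).
  exact: (variation_circle _ _ (fun s => slice2 _ _ _ (df (y1, s)))
      (continuous_slice2 _ y1 c2f)).
clearbody A B F1 F2.
have mB1 : measurable_fun setT (fun y : mR * mR => B y.1) by exact: measurableT_comp.
have mA2 : measurable_fun setT (fun y : mR * mR => A y.2) by exact: measurableT_comp.
have mT := torus_setT l1 l2 hl1 hl2; have aeC := ae_cell l1 l2.
have F0 (z : (mR * mR) * (mR * mR)) : (0 <= `|f z.1 - f z.2|%:E)%E by rewrite lee_fin.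
have mII := measurable_integral_fst (fun z => `|f z.1 - f z.2|%:E)%E mF F0.
move: (torus_measure l1 l2) mII mT aeC EA EB => nu mII mT aeC EA EB.
have c0 : (0 <= \int[nu]_y B y.1)%E by apply: integral_ge0.
apply: (@le_trans _ _ (\int[nu]_x ((l1 * l2)%:E * A x.2 + \int[nu]_y B y.1))%E).
  apply: ae_ge0_le_integral => //.
  - by move=> x _; apply: integral_ge0 => y _; rewrite lee_fin.
  - by move=> x _; rewrite adde_ge0 ?mule_ge0//; apply: integral_ge0.
  - by apply: emeasurable_funD => //; exact: measurable_funeM.
  apply: (filterS _ aeC) => x xc _.
  apply: (@le_trans _ _ (\int[nu]_y (A x.2 + B y.1))%E).
    apply: ae_ge0_le_integral => //.
    - exact: (measurableT_comp mF (measurable_pair1 x)).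
    - by move=> y _; rewrite adde_ge0.
    - exact: (emeasurable_funD (measurable_cst (A x.2)) mB1).
    by apply: (filterS _ aeC) => y yc _; exact: pt.
  by rewrite ge0_integralD//= integral_cst// mT muleC.
move: (\int[nu]_y B y.1)%E c0 EB => c c0 EB.
rewrite ge0_integralD//=; [|by move=> x _; rewrite mule_ge0|exact: measurable_funeM].
rewrite ge0_integralZl// EA integral_cst// mT EB [X in (_ + X <= _)%E]muleC.
have i1 : (0 <= \int[nu]_x F1 x)%E by apply: integral_ge0.
have i2 : (0 <= \int[nu]_x F2 x)%E by apply: integral_ge0.
by rewrite -ge0_muleDr// mule_ge0// lee_fin ltW.
Qed.

End poincare.

(** * Integrals of nonnegative functions and Lebesgue norms *)

Section nonnegative_integrals.
Context {R : realType} (l1 l2 : R).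
Hypotheses (hl1 : 0 < l1) (hl2 : 0 < l2).
Notation mR := (measurableTypeR R).
Notation mu := (torus_measure l1 l2).
Implicit Types f g : R * R -> R.

(** The hypotheses under which the integral is additive and monotone in the
    extended reals, without integrability conditions. *)
Definition nn_measurable f := (forall x, 0 <= f x) /\ measurable_fun setT (f : mR * mR -> mR).

Definition torus_int f : \bar R := (\int[mu]_x (f x)%:E)%E.

Lemma torus_aeS (P Q : R * R -> Prop) : (forall x, P x -> Q x) ->
  {ae mu, forall x, P x} -> {ae mu, forall x, Q x}.
Proof. by move=> PQ; apply: (@filterS _ _ (ae_filter_ringOfSetsType mu)). Qed.

Lemma torus_aeI (P Q : R * R -> Prop) :
  {ae mu, forall x, P x} -> {ae mu, forall x, Q x} -> {ae mu, forall x, P x /\ Q x}.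
Proof. exact: (@filterI _ _ (ae_filter_ringOfSetsType mu)). Qed.

Lemma nn_measurable_EFin f : nn_measurable f ->
  measurable_fun setT ((fun x => (f x)%:E) : mR * mR -> \bar R).
Proof. by move=> [_ mf]; exact/measurable_EFinP. Qed.

Lemma torus_int_ge0 f : nn_measurable f -> (0 <= torus_int f)%E.
Proof. by move=> [f0 _]; apply: integral_ge0 => x _; rewrite lee_fin. Qed.

Lemma nn_measurable_cst (a : R) : 0 <= a -> nn_measurable (fun=> a).
Proof. by move=> a0; split => //; exact: measurable_cst. Qed.

Lemma nn_measurableD f g : nn_measurable f -> nn_measurable g -> nn_measurable (fun x => f x + g x).
Proof.
move=> [f0 mf] [g0 mg]; split; first by move=> x; rewrite addr_ge0.
exact: measurable_funD.
Qed.

Lemma nn_measurableM f g : nn_measurable f -> nn_measurable g -> nn_measurable (fun x => f x * g x).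
Proof.
move=> [f0 mf] [g0 mg]; split; first by move=> x; rewrite mulr_ge0.
exact: measurable_funM.
Qed.

Lemma nn_measurableZ a f : 0 <= a -> nn_measurable f -> nn_measurable (fun x => a * f x).
Proof. by move=> a0 nf; exact: nn_measurableM (nn_measurable_cst _ a0) nf. Qed.

Lemma torus_intD f g : nn_measurable f -> nn_measurable g ->
  torus_int (fun x => f x + g x) = (torus_int f + torus_int g)%E.
Proof.
move=> nf ng; rewrite /torus_int; under eq_integral do rewrite EFinD.
apply: ge0_integralD => //.
- by move=> x _; rewrite lee_fin; apply nf.
- exact: nn_measurable_EFin.
- by move=> x _; rewrite lee_fin; apply ng.
- exact: nn_measurable_EFin.
Qed.

Lemma torus_intZ a f : 0 <= a -> nn_measurable f ->
  torus_int (fun x => a * f x) = (a%:E * torus_int f)%E.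
Proof.
move=> a0 nf; rewrite /torus_int; under eq_integral do rewrite EFinM.
apply: ge0_integralZl_EFin => //.
- by move=> x _; rewrite lee_fin; apply nf.
- exact: nn_measurable_EFin.
Qed.

Lemma torus_int_cst a : torus_int (fun=> a) = (a * (l1 * l2))%:E.
Proof. by rewrite /torus_int integral_cst//= torus_setT. Qed.

Lemma torus_int_le_ae f g : nn_measurable f -> nn_measurable g -> {ae mu, forall x, f x <= g x} ->
  (torus_int f <= torus_int g)%E.
Proof.
move=> nf ng fg; apply: ae_ge0_le_integral => //.
- by move=> x _; rewrite lee_fin; apply nf.
- exact: nn_measurable_EFin.
- by move=> x _; rewrite lee_fin; apply ng.
- exact: nn_measurable_EFin.
by apply: torus_aeS fg => x fgx _; rewrite lee_fin.
Qed.

Lemma torus_int_le f g : nn_measurable f -> nn_measurable g ->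
  (forall x, f x <= g x) -> (torus_int f <= torus_int g)%E.
Proof. by move=> nf ng fg; apply: torus_int_le_ae => //; exact: aeW. Qed.

Lemma integral_eq0_ae (F : mR * mR -> \bar R) : measurable_fun setT F ->
  (forall x, 0 <= F x)%E -> (\int[mu]_x F x <= 0)%E -> {ae mu, forall x, F x = 0%E}.
Proof.
move=> mF F0 iF.
have : (\int[mu]_x `|F x| = 0)%E.
  apply/eqP; rewrite eq_le integral_ge0 ?andbT => [|x _]; last exact: abse_ge0.
  by under eq_integral do rewrite gee0_abs//.
by move/(ae_eq_integral_abs mu measurableT mF); apply: torus_aeS => x /(_ I).
Qed.

Lemma torus_int_eq0_ae f : nn_measurable f -> (forall e, 0 < e -> (torus_int f <= e%:E)%E) ->
  {ae mu, forall x, f x = 0}.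
Proof.
move=> nf h.
have : {ae mu, forall x, (f x)%:E = 0%E}.
  apply: integral_eq0_ae; first exact: nn_measurable_EFin.
    by move=> x; rewrite lee_fin; apply nf.
  by apply/lee_addgt0Pr => e e0; rewrite add0e; exact: h.
by apply: torus_aeS => x [].
Qed.

(** The torus has finite measure, so L^2 controls L^1: integrate
    |f| <= s + f^2 / s. *)
Lemma torus_int_abs_le (s : R) f : 0 < s -> measurable_fun setT (f : mR * mR -> mR) ->
  (torus_int (fun x => f x ^+ 2)%R <= (s ^+ 2)%:E)%E ->
  (torus_int (fun x => `|f x|)%R <= (s * (l1 * l2 + 1))%:E)%E.
Proof.
move=> s0 mf fs.
have nf2 : nn_measurable (fun x => f x ^+ 2).
  by split=> [x|]; [exact: sqr_ge0|exact: measurable_funX].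
have nfa : nn_measurable (fun x => `|f x|).
  by split=> //; exact: measurableT_comp.
have sV0 : 0 <= s^-1 by rewrite invr_ge0 ltW.
apply: (@le_trans _ _ (torus_int (fun x => s + s^-1 * f x ^+ 2)%R)).
  apply: torus_int_le => //.
    by apply: nn_measurableD; [exact: nn_measurable_cst (ltW s0)|exact: nn_measurableZ].
  move=> x; rewrite -subr_ge0 -real_normK ?num_real//.
  have -> : s + s^-1 * `|f x| ^+ 2 - `|f x| =
            s^-1 * ((s - `|f x| / 2) ^+ 2 + 3 / 4 * `|f x| ^+ 2).
    by field; rewrite gt_eqF.
  by rewrite mulr_ge0// addr_ge0 ?sqr_ge0// mulr_ge0 ?sqr_ge0.
rewrite torus_intD; [|exact: nn_measurable_cst (ltW s0)|exact: nn_measurableZ].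
rewrite torus_intZ// torus_int_cst.
apply: (@le_trans _ _ ((s * (l1 * l2))%:E + s^-1%:E * (s ^+ 2)%:E)%E).
  by rewrite leeD2l// lee_wpmul2l// lee_fin.
have -> : s * (l1 * l2 + 1) = s * (l1 * l2) + s^-1 * s ^+ 2.
  by field; rewrite gt_eqF.
by rewrite EFinD EFinM.
Qed.

Lemma nn_measurable_nsq (u : spinor_field R) : measurable_field u ->
  nn_measurable (fun x => nsq (u x)).
Proof.
move=> mu_; split=> [x|]; first exact: nsq_ge0.
have m1 j : measurable_fun setT ((fun x => re (u x) j ^+ 2 + im (u x) j ^+ 2) : mR * mR -> mR).
  by have [mr mi] := mu_ j; apply: measurable_funD; exact: measurable_funX.
have -> : (fun x => nsq (u x)) = (fun x =>
    ((re (u x) c1 ^+ 2 + im (u x) c1 ^+ 2) + (re (u x) c2 ^+ 2 + im (u x) c2 ^+ 2)) +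
    (re (u x) c3 ^+ 2 + im (u x) c3 ^+ 2) + (re (u x) c4 ^+ 2 + im (u x) c4 ^+ 2)).
  by apply/funext => x; rewrite /nsq sum_components.
exact: (measurable_funD (measurable_funD (measurable_funD (m1 c1) (m1 c2)) (m1 c3)) (m1 c4)).
Qed.

Lemma measurable_fieldB (u v : spinor_field R) :
  measurable_field u -> measurable_field v -> measurable_field (fun x => u x - v x).
Proof.
move=> mu_ mv j; have [ur ui] := mu_ j; have [vr vi] := mv j; split.
  have -> : (fun x : mR * mR => complex.Re ((u x - v x) j 0) : mR) =
     (fun x => complex.Re (u x j 0) - complex.Re (v x j 0)).
    by apply/funext => x; rewrite !mxE raddfB.
  exact: measurable_funB.
have -> : (fun x : mR * mR => complex.Im ((u x - v x) j 0) : mR) =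
   (fun x => complex.Im (u x j 0) - complex.Im (v x j 0)).
  by apply/funext => x; rewrite !mxE raddfB.
exact: measurable_funB.
Qed.

Lemma measurable_field_cst (a : spinor R) : measurable_field (fun=> a).
Proof. by move=> j; split; exact: measurable_cst. Qed.

Lemma smooth_measurable (v : spinor_field R) : smooth_field v -> measurable_field v.
Proof.
by move=> sv j; have [s1 s2] := sv j; split; apply: continuous_plane_measurable;
  exact: smooth_continuous.
Qed.

Lemma smooth_field_partial1 (v : spinor_field R) :
  smooth_field v -> smooth_field (partial (e1 R) v).
Proof.
move=> sv j; have [s1 s2] := sv j; split.
  have := smooth_D1 _ s1; congr smooth; apply/funext => x.
  exact: esym (re_partial (e1 R) v x j).
have := smooth_D1 _ s2; congr smooth; apply/funext => x.
exact: esym (im_partial (e1 R) v x j).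
Qed.

Lemma smooth_field_partial2 (v : spinor_field R) :
  smooth_field v -> smooth_field (partial (e2 R) v).
Proof.
move=> sv j; have [s1 s2] := sv j; split.
  have := smooth_D2 _ s1; congr smooth; apply/funext => x.
  exact: esym (re_partial (e2 R) v x j).
have := smooth_D2 _ s2; congr smooth; apply/funext => x.
exact: esym (im_partial (e2 R) v x j).
Qed.

Lemma Lnorm_torus_pow (p : R) f : 0 < p ->
  (Lnorm_torus l1 l2 p f `^ p)%E = torus_int (fun x => `|f x| `^ p).
Proof.
move=> p0; rewrite /Lnorm_torus Lnorm.unlock -poweRrM mulVf ?gt_eqF// poweRe1.
  by apply: eq_integral => x _; exact: poweR_EFin.
by apply: integral_ge0 => x _; exact: poweR_ge0.
Qed.

Lemma Lnorm_torus_le (p k : R) f : 0 < p -> 0 <= k ->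
  (Lnorm_torus l1 l2 p f <= k%:E)%E -> (torus_int (fun x => `|f x| `^ p)%R <= (k `^ p)%:E)%E.
Proof.
move=> p0 k0 h; rewrite -Lnorm_torus_pow// -poweR_EFin.
have L0 : (0 <= Lnorm_torus l1 l2 p f)%E by exact: Lnorm_ge0.
by apply: gt0_ler_poweR => //; rewrite ?ltW// in_itv/= ?L0 ?lee_fin ?k0 ?leey.
Qed.

Lemma spinor_norm_pow2 (a : spinor R) : `|spinor_norm a| `^ 2 = nsq a.
Proof.
by rewrite spinor_normE powR_mulrn// real_normK ?num_real// sqr_sqrtr// nsq_ge0.
Qed.

Lemma spinor_norm_pow4 (a : spinor R) : `|spinor_norm a| `^ 4 = nsq a ^+ 2.
Proof.
rewrite spinor_normE powR_mulrn// (exprM _ 2 2) real_normK ?num_real//.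
by rewrite sqr_sqrtr// nsq_ge0.
Qed.

Lemma L2_cvg_small (un : nat -> spinor_field R) u e : 0 < e -> L2_cvg l1 l2 un u ->
  \forall n \near \oo, (torus_int (fun x => nsq (un n x - u x))%R <= e%:E)%E.
Proof.
move=> e0 cu.
have se0 : 0 < Num.sqrt e by rewrite sqrtr_gt0.
have : nbhs (0%E : \bar R) [set y | (y < (Num.sqrt e)%:E)%E].
  by apply: open_nbhs_nbhs; split; [exact: open_ereal_lt_ereal|rewrite /= lte_fin].
move=> /cu /= h0.
apply: (@filterS _ _ eventually_filter _ _ _ h0) => n /= /ltW h.
have /(_ _ _ h) := @Lnorm_torus_le 2 (Num.sqrt e) (fun x => spinor_norm (un n x - u x)).
rewrite powR_mulrn ?sqrtr_ge0// sqr_sqrtr; last exact: ltW.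
under [X in torus_int X]funext do rewrite spinor_norm_pow2.
by apply; rewrite ?sqrtr_ge0.
Qed.

End nonnegative_integrals.

(** * Approximation of eigenfields *)

Section eigenfields.
Context {R : realType} (l1 l2 : R).
Hypotheses (hl1 : 0 < l1) (hl2 : 0 < l2).
Notation mR := (measurableTypeR R).
Notation mu := (torus_measure l1 l2).
Notation N u := (torus_int l1 l2 (fun x => nsq (u x))).

Lemma torus_ae_exists (P : R * R -> Prop) : {ae mu, forall x, P x} -> exists x, P x.
Proof.
move=> [A [mA A0 PA]]; apply: contrapT => nP.
have : (mu setT <= mu A)%E.
  apply: le_measure; rewrite ?inE//.
  by move=> x _; apply: PA => /= Px; apply: nP; exists x.
by rewrite A0 torus_setT// lee_fin leNgt mulr_gt0.
Qed.

Lemma H1_approx (u w1 w2 : spinor_field R) e : 0 < e -> H1_partials l1 l2 u w1 w2 ->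
  exists v : spinor_field R, [/\ Defs.periodic l1 l2 v, smooth_field v,
    (N (fun x => v x - u x)%R <= e%:E)%E,
    (N (fun x => partial (e1 R) v x - w1 x)%R <= e%:E)%E &
    (N (fun x => partial (e2 R) v x - w2 x)%R <= e%:E)%E].
Proof.
move=> e0 [_ _ _ [un [sun c0 c1 c2]]].
have h := @filterI _ _ eventually_filter _ _ (L2_cvg_small _ _ _ _ _ e0 c0)
  (@filterI _ _ eventually_filter _ _ (L2_cvg_small _ _ _ _ _ e0 c1)
    (L2_cvg_small _ _ _ _ _ e0 c2)).
have [n [h0 [h1 h2]]] := @filter_ex _ _ eventually_filter _ h.
by have [pn sn] := sun n; exists (un n).
Qed.

Lemma Lp2_finite (u : spinor_field R) : Lp_field l1 l2 2 u ->
  exists2 U : R, 0 <= U & N u = U%:E.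
Proof.
move=> [_ mu_ hu]; have nu_ := nn_measurable_nsq _ mu_.
have N0 := torus_int_ge0 l1 l2 _ nu_.
have NE : (Lnorm_field l1 l2 2 u `^ 2)%E = N u.
  rewrite /Lnorm_field Lnorm_torus_pow//.
  by congr torus_int; apply/funext => x; exact: spinor_norm_pow2.
have Nf : N u \is a fin_num by rewrite ge0_fin_numE// -NE poweR_lty.
exists (fine (N u)); first exact: fine_ge0.
by rewrite fineK.
Qed.

(** Let v be smooth, at squared H^1 distance at most t^2 from u.  Then D v = lam v + r with
    |r|^2 integrating to at most a multiple of t^2, so that
    |D v|^2 <= (1 + t) lam^2 |v|^2 + (1 + 1/t) |r|^2.  Inserted in the energy
    identity, whose term lam^2 |v|^2 cancels, this bounds the gradient of v by a
    multiple of t. *)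
Lemma eigen_approx (m zeta lam : R) (u w1 w2 : spinor_field R) :
  lam ^+ 2 = zeta ^+ 2 + m ^+ 2 -> H1_partials l1 l2 u w1 w2 ->
  {ae mu, forall x, symbol m zeta (u x) (w1 x) (w2 x) = lam%:C%C *: u x} ->
  forall delta, 0 < delta -> exists v : spinor_field R,
    [/\ smooth_field v, (N (fun x => v x - u x)%R <= delta%:E)%E,
    (N (partial (e1 R) v) + N (partial (e2 R) v) <= delta%:E)%E,
    (N (fun x => partial (e1 R) v x - w1 x)%R <= delta%:E)%E &
    (N (fun x => partial (e2 R) v x - w2 x)%R <= delta%:E)%E].
Proof.
move=> lamE H1 aeu delta delta0.
have [Lu Lw1 Lw2 _] := H1.
have [U U0 UE] := Lp2_finite _ Lu.
have lam0 : 0 <= lam ^+ 2 by exact: sqr_ge0.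
pose K : R := 16 + 10 * lam ^+ 2.
have K0 : 0 <= K by rewrite addr_ge0// mulr_ge0.
pose C : R := lam ^+ 2 * (2 + 2 * U) + 2 * K + 1.
have C1 : 1 <= C.
  have U2 : 0 <= 2 + 2 * U by lra.
  by rewrite lerDr; apply: addr_ge0; exact: mulr_ge0.
have C0 : 0 < C by rewrite (lt_le_trans ltr01).
pose t := Num.min 1 (delta / C).
have t0 : 0 < t by rewrite lt_min ltr01 divr_gt0.
have t1 : t <= 1 by rewrite ge_min lexx.
have tC : t * C <= delta by rewrite -ler_pdivlMr// ge_min lexx orbT.
have td : t <= delta by rewrite (le_trans _ tC)// ler_peMr// ltW.
have e0 : 0 < t ^+ 2 by rewrite exprn_gt0.
have etd : t ^+ 2 <= delta by rewrite (le_trans _ td)// expr2 ler_piMl// ltW.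
have [v [pv sv v0 v1 v2]] := H1_approx _ _ _ _ e0 H1.
exists v; split => //; [by rewrite (le_trans v0)| |by rewrite (le_trans v1)|
  by rewrite (le_trans v2)].
have [csym energyE] := energy _ _ hl1 hl2 m zeta v pv sv.
have nsym : nn_measurable (fun x =>
    nsq (symbol m zeta (v x) (partial (e1 R) v x) (partial (e2 R) v x))).
  by split=> [x|]; [exact: nsq_ge0|exact: continuous_plane_measurable].
have mu_ : measurable_field u by case: Lu.
have mw1 : measurable_field w1 by case: Lw1.
have mw2 : measurable_field w2 by case: Lw2.
have mv := smooth_measurable _ sv.
have mp1 := smooth_measurable _ (smooth_field_partial1 _ sv).
have mp2 := smooth_measurable _ (smooth_field_partial2 _ sv).
have nv := nn_measurable_nsq _ mv; have nu_ := nn_measurable_nsq _ mu_.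
have np1 := nn_measurable_nsq _ mp1; have np2 := nn_measurable_nsq _ mp2.
have nd := nn_measurable_nsq _ (measurable_fieldB _ _ mv mu_).
have nd1 := nn_measurable_nsq _ (measurable_fieldB _ _ mp1 mw1).
have nd2 := nn_measurable_nsq _ (measurable_fieldB _ _ mp2 mw2).
have tV0 : 0 <= 1 + t^-1 by rewrite addr_ge0// invr_ge0 ltW.
have t10 : 0 <= 1 + t by rewrite addr_ge0// ltW.
have k8 : 0 <= 8 :> R by [].
have k2 : 0 <= 2 :> R by [].
have k10 : 0 <= 10 * lam ^+ 2 by rewrite mulr_ge0.
(* Only the defect of v in the equation D v = lam v enters the second term. *)
have up : (N (fun x => symbol m zeta (v x) (partial (e1 R) v x) (partial (e2 R) v x))%R <=
  ((1 + t) * lam ^+ 2)%:E * N v + (1 + t^-1)%:E *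
   (8%:E * N (fun x => partial (e1 R) v x - w1 x)%R
  + 8%:E * N (fun x => partial (e2 R) v x - w2 x)%R
  + (10 * lam ^+ 2)%:E * N (fun x => v x - u x)%R))%E.
  have n1 := nn_measurableZ _ _ k8 nd1; have n2 := nn_measurableZ _ _ k8 nd2.
  have n3 := nn_measurableZ _ _ k10 nd.
  have n12 := nn_measurableD _ _ n1 n2; have n123 := nn_measurableD _ _ n12 n3.
  have tl : 0 <= (1 + t) * lam ^+ 2 by rewrite mulr_ge0.
  have nA := nn_measurableZ _ _ tl nv; have nB := nn_measurableZ _ _ tV0 n123.
  rewrite -(torus_intZ _ _ _ _ k8 nd1) -(torus_intZ _ _ _ _ k8 nd2) -(torus_intZ _ _ _ _ k10 nd).
  rewrite -(torus_intD _ _ _ _ n1 n2) -(torus_intD _ _ _ _ n12 n3).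
  rewrite -(torus_intZ _ _ _ _ tV0 n123) -(torus_intZ _ _ _ _ tl nv) -(torus_intD _ _ _ _ nA nB).
  apply: torus_int_le_ae => //; first exact: nn_measurableD.
  apply: torus_aeS aeu => x ux.
  have -> : symbol m zeta (v x) (partial (e1 R) v x) (partial (e2 R) v x) =
     lam%:C%C *: v x + (symbol m zeta (v x - u x) (partial (e1 R) v x - w1 x)
       (partial (e2 R) v x - w2 x) + (- lam)%:C%C *: (v x - u x)).
    rewrite symbolB ux rmorphN/= scaleNr scalerBr opprB.
    have cancel (S p q : spinor R) : S = p + (S - q + (q - p)).
      by rewrite [X in p + X]addrA (subrK q S) (addrC p) (subrK p S).
    exact: cancel.
  apply: (le_trans (nsqD_le _ _ _ t0)).
  rewrite nsqZ -mulrA lerD2l ler_wpM2l//.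
  apply: (le_trans (nsqD2 _ _)); rewrite nsqZ sqrrN.
  have := nsq_symbol_le m zeta (v x - u x) (partial (e1 R) v x - w1 x)
     (partial (e2 R) v x - w2 x); rewrite -lamE.
  move: (nsq (symbol _ _ _ _ _)) (nsq (v x - u x)) (nsq (_ - w1 x)) (nsq (_ - w2 x)) (lam ^+ 2).
  by move=> S a b c l; lra.
have vle : (N v <= (2 + 2 * U)%:E)%E.
  apply: (@le_trans _ _ (2%:E * N (fun x => v x - u x)%R + 2%:E * N u)%E).
    rewrite -(torus_intZ _ _ _ _ k2 nd) -(torus_intZ _ _ _ _ k2 nu_).
    rewrite -torus_intD; [|exact: nn_measurableZ|exact: nn_measurableZ].
    apply: torus_int_le => //; first by apply: nn_measurableD; exact: nn_measurableZ.
    by move=> x; rewrite -{1}(subrK (u x) (v x)); exact: nsqD2.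
  rewrite UE (_ : (2 + 2 * U)%:E = (2%:E + 2%:E * U%:E)%E) //; apply: leeD => //.
  rewrite -[leRHS]mule1; apply: lee_wpmul2l => //.
  by rewrite (le_trans v0)// lee_fin expr_le1// ltW.
have [V V0 VE] : exists2 V : R, 0 <= V & N v = V%:E.
  have := torus_int_ge0 l1 l2 _ nv; move: vle; case: (N v) => [V| |] //= _; rewrite lee_fin => V0.
  by exists V.
have nl := nn_measurableZ _ _ lam0 nv.
have E : N (fun x => symbol m zeta (v x) (partial (e1 R) v x) (partial (e2 R) v x))%R =
   (N (partial (e1 R) v) + N (partial (e2 R) v) + (lam ^+ 2 * V)%:E)%E.
  rewrite EFinM -VE -(torus_intZ _ _ _ _ lam0 nv) -(torus_intD _ _ _ _ np1 np2).
  rewrite -(torus_intD _ _ _ _ (nn_measurableD _ _ np1 np2) nl).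
  by rewrite lamE; exact: energyE.
rewrite -(leeD2rE (x := (lam ^+ 2 * V)%:E))// -E (le_trans up)//.
rewrite VE.
apply: (@le_trans _ _ (((1 + t) * lam ^+ 2)%:E * V%:E + (1 + t^-1)%:E *
   (8%:E * (t ^+ 2)%:E + 8%:E * (t ^+ 2)%:E + (10 * lam ^+ 2)%:E * (t ^+ 2)%:E))%E).
  rewrite leeD2l// lee_wpmul2l ?lee_fin//.
  by do 2?[apply: leeD]; rewrite lee_wpmul2l ?lee_fin.
rewrite [leLHS](_ : _ = ((1 + t) * lam ^+ 2 * V + (1 + t^-1) *
  (8 * t ^+ 2 + 8 * t ^+ 2 + 10 * lam ^+ 2 * t ^+ 2))%:E) // -EFinD lee_fin.
have Vle : V <= 2 + 2 * U by move: vle; rewrite VE lee_fin.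
have -> : (1 + t^-1) * (8 * t ^+ 2 + 8 * t ^+ 2 + 10 * lam ^+ 2 * t ^+ 2) =
   K * (t * (1 + t)) by rewrite /K; field; rewrite gt_eqF.
rewrite (le_trans _ (lerD tC (lexx (lam ^+ 2 * V))))//.
have h1 : lam ^+ 2 * V <= lam ^+ 2 * (2 + 2 * U) by rewrite ler_wpM2l.
have h2 : t * (lam ^+ 2 * V) <= t * (lam ^+ 2 * (2 + 2 * U)) by rewrite ler_wpM2l// ltW.
have h3 : K * (t * (1 + t)) <= K * (t * 2).
  by apply: ler_wpM2l => //; apply: ler_wpM2l (ltW t0) _ _ _; lra.
have h4 : t * C = t * (lam ^+ 2 * (2 + 2 * U)) + K * (t * 2) + t by rewrite /C; ring.
have -> : (1 + t) * lam ^+ 2 * V = lam ^+ 2 * V + t * (lam ^+ 2 * V) by ring.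
move: h2 h3 h4 t0; move: (t * C) (lam ^+ 2 * V) (t * (lam ^+ 2 * V)) (K * (t * (1 + t)))
  (t * (lam ^+ 2 * (2 + 2 * U))) => c p q r w h2 h3 h4 t0.
lra.
Qed.


End eigenfields.

(** * Eigenfields are constant *)

Section constancy.
Context {R : realType} (l1 l2 : R).
Hypotheses (hl1 : 0 < l1) (hl2 : 0 < l2).
Notation mR := (measurableTypeR R).
Notation mu := (torus_measure l1 l2).
Notation N u := (torus_int l1 l2 (fun x => nsq (u x))).

Lemma measurable_diff (f g : R * R -> R) :
  measurable_fun setT (f : mR * mR -> mR) -> measurable_fun setT (g : mR * mR -> mR) ->
  measurable_fun setT ((fun z => `|f z.1 - g z.2|%:E) : (mR * mR) * (mR * mR) -> \bar R).
Proof.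
move=> mf mg; apply/measurable_EFinP; apply: measurableT_comp => //.
by apply: measurable_funB; exact: measurableT_comp.
Qed.

Lemma diff_ge0 (f g : R * R -> R) (z : (mR * mR) * (mR * mR)) :
  (0 <= `|f z.1 - g z.2|%:E)%E.
Proof. by rewrite lee_fin. Qed.

(** Triangle inequality through g x and g y. *)
Lemma oscillation_le (f g : R * R -> R) :
  measurable_fun setT (f : mR * mR -> mR) -> measurable_fun setT (g : mR * mR -> mR) ->
  (\int[mu]_x \int[mu]_y `|f x - f y|%:E <=
   (2 * (l1 * l2))%:E * torus_int l1 l2 (fun x => `|g x - f x|)%R
   + \int[mu]_x \int[mu]_y `|g x - g y|%:E)%E.
Proof.
move=> mf mg.
have T0 : 0 <= l1 * l2 by rewrite mulr_ge0// ltW.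
have mffII := measurable_integral_fst l1 l2 hl1 hl2 _ (measurable_diff _ _ mf mf) (diff_ge0 f f).
have mggII := measurable_integral_fst l1 l2 hl1 hl2 _ (measurable_diff _ _ mg mg) (diff_ge0 g g).
have nh : nn_measurable (fun x => `|g x - f x|).
  by split=> //; apply: measurableT_comp => //; exact: measurable_funB.
have ngg x : nn_measurable (fun y => `|g x - g y|).
  split=> //; apply: measurableT_comp => //; apply: measurable_funB => //.
have nff x : nn_measurable (fun y => `|f x - f y|).
  split=> //; apply: measurableT_comp => //; apply: measurable_funB => //.
set D := torus_int l1 l2 _; set P := (X in (_ <= _ + X)%E).
have D0 : (0 <= D)%E by exact: torus_int_ge0.
have iE x : (\int[mu]_y `|f x - f y|%:E <=
    (l1 * l2 * `|g x - f x|)%:E + D + \int[mu]_y `|g x - g y|%:E)%E.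
  have nc : nn_measurable (fun=> `|g x - f x| : R) by exact: nn_measurable_cst.
  have nch := nn_measurableD _ _ nc nh.
  have -> : (l1 * l2 * `|g x - f x|)%:E = torus_int l1 l2 (fun=> `|g x - f x|).
    by rewrite torus_int_cst// mulrC.
  rewrite /D -torus_intD//.
  rewrite -[X in (_ + X)%E]/(torus_int l1 l2 (fun y => `|g x - g y|)) -torus_intD//.
  apply: torus_int_le => //; first exact: nn_measurableD.
  move=> y; have -> : f x - f y = - (g x - f x) + (g y - f y) + (g x - g y) by ring.
  rewrite (le_trans (ler_normD _ _))// lerD2r (le_trans (ler_normD _ _))//.
  by rewrite normrN.
have mh := nn_measurable_EFin _ (nn_measurableZ _ _ T0 nh).
apply: (@le_trans _ _ (\int[mu]_x ((l1 * l2 * `|g x - f x|)%:E + D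
   + \int[mu]_y `|g x - g y|%:E))%E).
  apply: ge0_le_integral => //.
  - by move=> x _; apply: integral_ge0 => y _; rewrite lee_fin.
  - apply: emeasurable_funD => //; apply: emeasurable_funD => //.
rewrite ge0_integralD//; last 3 first.
- by move=> x _; rewrite adde_ge0// lee_fin mulr_ge0.
- by apply: emeasurable_funD.
- by move=> x _; apply: integral_ge0 => y _; rewrite lee_fin.
rewrite leeD2r//.
rewrite ge0_integralD//; last by move=> x _; rewrite lee_fin mulr_ge0.
rewrite -/(torus_int l1 l2 (fun x => l1 * l2 * `|g x - f x|)) torus_intZ// integral_cst//.
rewrite torus_setT// [X in (_ + X <= _)%E]muleC.
by rewrite (_ : 2 * (l1 * l2) = l1 * l2 + l1 * l2) ?EFinD ?ge0_muleDl//; ring.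
Qed.

(** By the Poincare inequality the double integral of |f x - f y| is at most a
    multiple of s for every s, hence zero. *)
Lemma constant_of_approx (f : R * R -> R) :
  measurable_fun setT (f : mR * mR -> mR) ->
  (forall s : R, 0 < s -> exists g : R * R -> R, [/\ smooth g,
    (torus_int l1 l2 (fun x => (g x - f x) ^+ 2)%R <= (s ^+ 2)%:E)%E,
    (torus_int l1 l2 (fun x => 'D_(e1 R) g x ^+ 2)%R <= (s ^+ 2)%:E)%E &
    (torus_int l1 l2 (fun x => 'D_(e2 R) g x ^+ 2)%R <= (s ^+ 2)%:E)%E]) ->
  {ae mu, forall x, {ae mu, forall y, f x = f y}}.
Proof.
move=> mf h.
have T0 : 0 < l1 * l2 by rewrite mulr_gt0.
have mffII := measurable_integral_fst l1 l2 hl1 hl2 _ (measurable_diff _ _ mf mf)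
  (diff_ge0 f f).
suff : (\int[mu]_x \int[mu]_y `|f x - f y|%:E <= 0)%E.
  move/(integral_eq0_ae _ _ _ mffII) => k.
  have {}k : {ae mu, forall x, (\int[mu]_y `|f x - f y|%:E = 0)%E}.
    by apply: k => x; apply: integral_ge0 => y _; rewrite lee_fin.
  apply: torus_aeS k => x kx.
  have nff : nn_measurable (fun y => `|f x - f y|).
    by split=> //; apply: measurableT_comp => //; exact: measurable_funB.
  have : {ae mu, forall y, `|f x - f y| = 0}.
    apply: torus_int_eq0_ae => // e e0; rewrite /torus_int kx lee_fin; exact: ltW.
  by apply: torus_aeS => y /eqP; rewrite normr_eq0 subr_eq0 => /eqP.
pose T1 := l1 * l2 + 1.
pose C := 2 * (l1 * l2) * T1 + l1 * l2 * (l1 * T1 + l2 * T1).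
have T10 : 0 < T1 by rewrite addr_gt0.
have C0 : 0 < C by rewrite addr_gt0 ?mulr_gt0 ?addr_gt0 ?mulr_gt0.
apply/lee_addgt0Pr => e e0; rewrite add0e.
have s0 : 0 < e / C by rewrite divr_gt0.
have [g [sg g0 g1 g2]] := h _ s0.
have cg := smooth_continuous _ sg.
have mg := continuous_plane_measurable _ cg.
have cg1 := smooth_continuous _ (smooth_D1 _ sg).
have cg2 := smooth_continuous _ (smooth_D2 _ sg).
have i0 := torus_int_abs_le _ _ hl1 hl2 _ (fun x => g x - f x) s0 (measurable_funB mg mf) g0.
have i1 := torus_int_abs_le _ _ hl1 hl2 _ _ s0 (continuous_plane_measurable _ cg1) g1.
have i2 := torus_int_abs_le _ _ hl1 hl2 _ _ s0 (continuous_plane_measurable _ cg2) g2.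
have po := torus_poincare _ _ hl1 hl2 g (smooth_differentiable _ sg) cg1 cg2.
apply: (le_trans (oscillation_le f g mf mg)).
set E := e / C in s0 i0 i1 i2.
apply: (@le_trans _ _ ((2 * (l1 * l2))%:E * (E * T1)%:E +
   (l1 * l2)%:E * (l1%:E * (E * T1)%:E + l2%:E * (E * T1)%:E))%E).
  apply: leeD; first by rewrite lee_wpmul2l// lee_fin mulr_ge0// ltW.
  apply: (le_trans po); apply: lee_wpmul2l; first by rewrite lee_fin ltW.
  apply: leeD.
    by apply: lee_wpmul2l; [rewrite lee_fin ltW|exact: i1].
  by apply: lee_wpmul2l; [rewrite lee_fin ltW|exact: i2].
rewrite [leLHS](_ : _ = (2 * (l1 * l2) * (E * T1)
   + l1 * l2 * (l1 * (E * T1) + l2 * (E * T1)))%:E) // lee_fin.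
rewrite (_ : _ + _ = E * C); last by rewrite /C; ring.
by rewrite /E divfK// gt_eqF.
Qed.

(** Each real and imaginary part is almost everywhere equal to its value at
    almost every point; a common such point x0 exists since finitely many sets of
    full measure meet.  The weak derivatives w1, w2 vanish, being limits of
    gradients that tend to zero, so the eigenvalue equation becomes algebraic. *)
Lemma eigen_constant (m zeta lam : R) (u w1 w2 : spinor_field R) :
  lam ^+ 2 = zeta ^+ 2 + m ^+ 2 -> H1_partials l1 l2 u w1 w2 ->
  {ae mu, forall x, symbol m zeta (u x) (w1 x) (w2 x) = lam%:C%C *: u x} ->
  exists c : spinor R, {ae mu, forall x, u x = c} /\
    symbol m zeta c 0 0 = lam%:C%C *: c.
Proof.
move=> lamE H1 aeu.
have ap := eigen_approx _ _ hl1 hl2 m zeta lam u w1 w2 lamE H1 aeu.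
have [Lu Lw1 Lw2 _] := H1.
have mu_ : measurable_field u by case: Lu.
have mw1 : measurable_field w1 by case: Lw1.
have mw2 : measurable_field w2 by case: Lw2.
have grad0 (w : spinor_field R) (p : spinor_field R -> spinor_field R) :
    measurable_field w -> (forall v, smooth_field v -> smooth_field (p v)) ->
    (forall delta, 0 < delta -> exists v : spinor_field R, [/\ smooth_field v,
      (N (p v) <= delta%:E)%E & (N (fun x => p v x - w x)%R <= delta%:E)%E]) ->
    {ae mu, forall x, w x = 0}.
  move=> mw sp h.
  suff : {ae mu, forall x, nsq (w x) = 0} by apply: torus_aeS => x /nsq_eq0.
  apply: torus_int_eq0_ae; first exact: nn_measurable_nsq.
  move=> e e0; have e40 : 0 < e / 4 by rewrite divr_gt0.
  have [v [sv v1 v2]] := h _ e40.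
  have np := nn_measurable_nsq _ (smooth_measurable _ (sp _ sv)).
  have nd := nn_measurable_nsq _ (measurable_fieldB _ _ (smooth_measurable _ (sp _ sv)) mw).
  have k2 : 0 <= 2 :> R by [].
  apply: (@le_trans _ _ (2%:E * N (p v) + 2%:E * N (fun x => p v x - w x)%R)%E).
    rewrite -(torus_intZ _ _ _ _ k2 nd) -(torus_intZ _ _ _ _ k2 np).
    rewrite -torus_intD; [|exact: nn_measurableZ|exact: nn_measurableZ].
    apply: torus_int_le => //; [exact: nn_measurable_nsq|
      by apply: nn_measurableD; exact: nn_measurableZ|].
    move=> x; have E : w x = p v x + - (p v x - w x) by rewrite opprB addrC subrK.
    rewrite [in leLHS]E.
    by apply: (le_trans (nsqD2 _ _)); rewrite nsqN.
  apply: (@le_trans _ _ (2%:E * (e / 4)%:E + 2%:E * (e / 4)%:E)%E).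
    by apply: leeD; rewrite lee_wpmul2l.
  rewrite [leLHS](_ : _ = (2 * (e / 4) + 2 * (e / 4))%:E) // lee_fin; lra.
have w10 : {ae mu, forall x, w1 x = 0}.
  apply: (grad0 w1 (partial (e1 R))) => //; first exact: smooth_field_partial1.
  move=> delta d0; have [v [sv _ v12 v1 _]] := ap _ d0; exists v; split => //.
  rewrite (le_trans _ v12)// leeDl//; apply: torus_int_ge0; apply: nn_measurable_nsq.
  exact/smooth_measurable/smooth_field_partial2.
have w20 : {ae mu, forall x, w2 x = 0}.
  apply: (grad0 w2 (partial (e2 R))) => //; first exact: smooth_field_partial2.
  move=> delta d0; have [v [sv _ v12 _ v2]] := ap _ d0; exists v; split => //.
  rewrite (le_trans _ v12)// leeDr//; apply: torus_int_ge0; apply: nn_measurable_nsq.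
  exact/smooth_measurable/smooth_field_partial1.
have comp (r : spinor R -> R) :
    (forall a, r a ^+ 2 <= nsq a) -> (forall a b, r (a - b) = r a - r b) ->
    (forall v, measurable_field v -> measurable_fun setT ((fun x => r (v x)) : mR * mR -> mR)) ->
    (forall v, smooth_field v -> smooth (fun x => r (v x))) ->
    (forall w v x, r (partial w v x) = 'D_w (fun y => r (v y)) x) ->
    {ae mu, forall x, {ae mu, forall y, r (u x) = r (u y)}}.
  move=> rle rB rm rs rp.
  apply: (constant_of_approx (fun x => r (u x))); first exact: rm.
  move=> s s0; have s20 : 0 < s ^+ 2 by rewrite exprn_gt0.
  have [v [sv v0 v12 _ _]] := ap _ s20.
  have mp1 := smooth_measurable _ (smooth_field_partial1 _ sv).
  have mp2 := smooth_measurable _ (smooth_field_partial2 _ sv).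
  have nd := measurable_fieldB _ _ (smooth_measurable _ sv) mu_.
  have nr w : measurable_field w -> nn_measurable (fun x => r (w x) ^+ 2).
    by move=> mw; split=> [x|]; [exact: sqr_ge0|exact: measurable_funX (rm _ mw)].
  have le w : measurable_field w -> (torus_int l1 l2 (fun x => r (w x) ^+ 2)%R <= N w)%E.
    by move=> mw; apply: torus_int_le => //; [exact: nr|exact: nn_measurable_nsq].
  exists (fun x => r (v x)); split; first exact: rs.
  - rewrite (le_trans _ v0)// (le_trans _ (le _ nd))//.
    by under [X in (_ <= torus_int _ _ X)%E]funext do rewrite rB.
  - rewrite (le_trans _ v12)// (@le_trans _ _ (N (partial (e1 R) v)))//.
      rewrite (le_trans _ (le _ mp1))//.
      by under [X in (_ <= torus_int _ _ X)%E]funext do rewrite rp.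
    by rewrite leeDl//; apply: torus_int_ge0; exact: nn_measurable_nsq.
  - rewrite (le_trans _ v12)// (@le_trans _ _ (N (partial (e2 R) v)))//.
      rewrite (le_trans _ (le _ mp2))//.
      by under [X in (_ <= torus_int _ _ X)%E]funext do rewrite rp.
    by rewrite leeDr//; apply: torus_int_ge0; exact: nn_measurable_nsq.
have compr j : {ae mu, forall x, {ae mu, forall y, re (u x) j = re (u y) j}}.
  apply: (comp (re^~ j)) => [a|a b|v mv|v sv|w v x].
  - exact: re_sqr_le.
  - by rewrite /re !mxE raddfB.
  - by have [] := mv j.
  - by have [] := sv j.
  - exact: re_partial.
have compi j : {ae mu, forall x, {ae mu, forall y, im (u x) j = im (u y) j}}.
  apply: (comp (im^~ j)) => [a|a b|v mv|v sv|w v x].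
  - exact: im_sqr_le.
  - by rewrite /im !mxE raddfB.
  - by have [] := mv j.
  - by have [] := sv j.
  - exact: im_partial.
have compc j : {ae mu, forall x,
    {ae mu, forall y, re (u x) j = re (u y) j /\ im (u x) j = im (u y) j}}.
  by apply: torus_aeS (torus_aeI _ _ _ _ (compr j) (compi j)) => x [/torus_aeI]; exact.
have [x0 [[[h1 h2] h3] h4]] := torus_ae_exists _ _ hl1 hl2 _
  (torus_aeI _ _ _ _ (torus_aeI _ _ _ _ (torus_aeI _ _ _ _ (compc c1) (compc c2)) (compc c3))
     (compc c4)).
have uc : {ae mu, forall x, u x = u x0}.
  apply: torus_aeS (torus_aeI _ _ _ _ (torus_aeI _ _ _ _ (torus_aeI _ _ _ _ h1 h2) h3) h4).
  move=> y [[[k1 k2] k3] k4]; apply: spinor_ext.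
  by apply: componentP; split; apply/esym; [apply k1|apply k1|apply k2|apply k2|
     apply k3|apply k3|apply k4|apply k4].
exists (u x0); split => //.
have [y [[[A B] C] D]] := torus_ae_exists _ _ hl1 hl2 _
  (torus_aeI _ _ _ _ (torus_aeI _ _ _ _ (torus_aeI _ _ _ _ aeu w10) w20) uc).
by rewrite B C D in A.
Qed.

End constancy.

(** * Quantitative estimates *)

Section estimates.
Context {R : realType} (l1 l2 : R).
Hypotheses (hl1 : 0 < l1) (hl2 : 0 < l2).
Notation mR := (measurableTypeR R).
Notation mu := (torus_measure l1 l2).

(** If s < b, then b = b^nu / b^(nu - 1) <= b^nu / s^(nu - 1). *)
Lemma le_add_powR (nu s b : R) : 1 < nu -> 0 < s -> 0 <= b ->
  b <= s + (s `^ (nu - 1))^-1 * b `^ nu.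
Proof.
move=> nu1 s0 b0.
have p0 : 0 < s `^ (nu - 1) by exact: powR_gt0.
have [bs|sb] := leP b s.
  by rewrite (le_trans bs)// lerDl mulr_ge0 ?powR_ge0// invr_ge0 ltW.
rewrite (@le_trans _ _ ((s `^ (nu - 1))^-1 * b `^ nu))//; last by rewrite lerDr ltW.
rewrite ler_pdivlMl// -(@mulr_powRB1 _ b nu)//; last exact: lt_trans nu1.
rewrite mulrC ler_wpM2l//.
by apply: ge0_ler_powR; rewrite ?nnegrE ?subr_ge0 // ltW.
Qed.

Lemma nn_measurable_bar (phi : spinor_field R) : measurable_field phi ->
  nn_measurable (fun x => `|bar (phi x)|).
Proof.
move=> mphi; split=> //; apply: measurableT_comp => //.
have m1 j : measurable_fun setT ((fun x => re (phi x) j ^+ 2 + im (phi x) j ^+ 2) : mR * mR -> mR).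
  by have [mr mi] := mphi j; apply: measurable_funD; exact: measurable_funX.
have -> : (fun x => bar (phi x)) = (fun x =>
    ((re (phi x) c1 ^+ 2 + im (phi x) c1 ^+ 2) + (re (phi x) c2 ^+ 2 + im (phi x) c2 ^+ 2)) -
    (re (phi x) c3 ^+ 2 + im (phi x) c3 ^+ 2) - (re (phi x) c4 ^+ 2 + im (phi x) c4 ^+ 2)).
  by apply/funext => x; rewrite barE.
exact: (measurable_funB (measurable_funB (measurable_funD (m1 c1) (m1 c2)) (m1 c3)) (m1 c4)).
Qed.

(** Here c is the constant spinor approximating phi.  [bar_perturb] with weight t
    absorbs half of bar c = 2 t |c|^2, leaving
    t |c|^2 <= |bar phi| + (1 + 1/t) |phi - c|^2; the parameter s turns the
    L^1 and L^2 norms on the right into L^nu and L^4 norms. *)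
Lemma constant_part_le (phi : spinor_field R) (c : spinor R) (t s nu B Q : R) :
  measurable_field phi -> 0 < t -> bar c = 2 * t * nsq c -> 0 < s -> 1 < nu ->
  (torus_int l1 l2 (fun x => `|bar (phi x)| `^ nu)%R <= B%:E)%E ->
  (torus_int l1 l2 (fun x => nsq (phi x - c) ^+ 2)%R <= Q%:E)%E ->
  t * nsq c * (l1 * l2) <= s * (l1 * l2) + (s `^ (nu - 1))^-1 * B
    + (1 + t^-1) * (s * (l1 * l2) + s^-1 * Q).
Proof.
move=> mphi t0 cE s0 nu1 hB hQ.
have nq := nn_measurable_nsq _ (measurable_fieldB _ _ mphi (measurable_field_cst c)).
have nb := nn_measurable_bar _ mphi.
have nbn : nn_measurable (fun x => `|bar (phi x)| `^ nu).
  split=> [x|]; first exact: powR_ge0.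
  exact: (measurableT_comp (measurable_powR nu) nb.2).
have nq2 : nn_measurable (fun x => nsq (phi x - c) ^+ 2).
  by split=> [x|]; [exact: sqr_ge0|exact: measurable_funX nq.2].
have p0 : 0 <= (s `^ (nu - 1))^-1 by rewrite invr_ge0 powR_ge0.
have sV0 : 0 <= s^-1 by rewrite invr_ge0 ltW.
have K0 : 0 <= 1 + t^-1 by rewrite addr_ge0// invr_ge0 ltW.
have ns := nn_measurable_cst s (ltW s0).
have nA1 := nn_measurableZ _ _ p0 nbn; have nA := nn_measurableD _ _ ns nA1.
have nB1 := nn_measurableZ _ _ sV0 nq2; have nB2 := nn_measurableD _ _ ns nB1.
have nB := nn_measurableZ _ _ K0 nB2.
have tc0 : 0 <= t * nsq c by rewrite mulr_ge0 ?nsq_ge0// ltW.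
have le1 : (torus_int l1 l2 (fun=> t * nsq c)%R <= torus_int l1 l2 (fun x =>
    (s + (s `^ (nu - 1))^-1 * `|bar (phi x)| `^ nu)
    + (1 + t^-1) * (s + s^-1 * nsq (phi x - c) ^+ 2))%R)%E.
  apply: torus_int_le; [exact: nn_measurable_cst|exact: nn_measurableD|move=> x].
  have h1 := le_add_powR nu s _ nu1 s0 (nb.1 x).
  have h2 : nsq (phi x - c) <= s + s^-1 * nsq (phi x - c) ^+ 2.
    have := le_add_powR 2 s _ (ltr1n _ 2) s0 (nq.1 x).
    have -> : 2 - 1 = 1 :> R by ring.
    by rewrite powRr1 ?(ltW s0)// powR_mulrn// nsq_ge0.
  have h3 : bar c - t * nsq c - (1 + t^-1) * nsq (phi x - c) <= bar (phi x).
    have := bar_perturb t c (phi x - c) t0.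
    by rewrite [c + _]addrC subrK.
  have h4 := ler_norm (bar (phi x)).
  have h5 := ler_wpM2l K0 h2.
  rewrite cE in h3; lra.
move: le1; rewrite torus_int_cst// torus_intD// torus_intD//.
rewrite torus_intZ// torus_intZ// torus_intD// torus_intZ// torus_int_cst// => le1.
rewrite -lee_fin (le_trans le1)// [leRHS](_ : _ = ((s * (l1 * l2))%:E
  + (s `^ (nu - 1))^-1%:E * B%:E
  + (1 + t^-1)%:E * ((s * (l1 * l2))%:E + s^-1%:E * Q%:E))%E)//.
apply: leeD; first by rewrite leeD2l// lee_wpmul2l.
by rewrite lee_wpmul2l// leeD2l// lee_wpmul2l.
Qed.

Lemma L4_split_le (phi : spinor_field R) (c : spinor R) (Q : R) :
  measurable_field phi -> torus_int l1 l2 (fun x => nsq (phi x) ^+ 2) = 1%E ->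
  (torus_int l1 l2 (fun x => nsq (phi x - c) ^+ 2)%R <= Q%:E)%E ->
  1 <= 8 * nsq c ^+ 2 * (l1 * l2) + 8 * Q.
Proof.
move=> mphi h1 hQ.
have nq := nn_measurable_nsq _ (measurable_fieldB _ _ mphi (measurable_field_cst c)).
have nq2 : nn_measurable (fun x => nsq (phi x - c) ^+ 2).
  by split=> [x|]; [exact: sqr_ge0|exact: measurable_funX nq.2].
have np2 : nn_measurable (fun x => nsq (phi x) ^+ 2).
  by split=> [x|]; [exact: sqr_ge0|exact: measurable_funX (nn_measurable_nsq _ mphi).2].
have k8 : 0 <= 8 :> R by [].
have a0 : 0 <= 8 * nsq c ^+ 2 by rewrite mulr_ge0 ?sqr_ge0.
have : (torus_int l1 l2 (fun x => nsq (phi x) ^+ 2)%R <=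
    torus_int l1 l2 (fun x => 8 * nsq c ^+ 2 + 8 * nsq (phi x - c) ^+ 2)%R)%E.
  apply: torus_int_le => //.
    by apply: nn_measurableD; [exact: nn_measurable_cst|exact: nn_measurableZ].
  move=> x; have h : nsq (phi x) <= 2 * nsq (phi x - c) + 2 * nsq c.
    by rewrite -{1}(subrK c (phi x)); exact: nsqD2.
  have p0 := nsq_ge0 (phi x); have c0 := nsq_ge0 c; have q0 := nq.1 x.
  rewrite (@le_trans _ _ ((2 * nsq (phi x - c) + 2 * nsq c) ^+ 2))//.
    by rewrite lerXn2r ?nnegrE// (le_trans p0).
  rewrite -subr_ge0.
  have -> : 8 * nsq c ^+ 2 + 8 * nsq (phi x - c) ^+ 2 -
    (2 * nsq (phi x - c) + 2 * nsq c) ^+ 2 = 4 * (nsq (phi x - c) - nsq c) ^+ 2 by ring.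
  by rewrite mulr_ge0 ?sqr_ge0.
rewrite h1 (torus_intD _ _ _ _ (nn_measurable_cst _ a0) (nn_measurableZ _ _ k8 nq2)).
rewrite torus_int_cst// torus_intZ// => /le_trans h.
have : (1 <= (8 * nsq c ^+ 2 * (l1 * l2))%:E + 8%:E * Q%:E)%E.
  by apply: h; rewrite leeD2l// lee_wpmul2l.
by rewrite lee_fin.
Qed.

End estimates.

(** * The lower bound for the orthogonal part *)

Theorem lemma4p1 (R : realType) (m l1 l2 l3 zeta : R)
    (hm : 0 < m) (hl1 : 0 < l1) (hl2 : 0 < l2) (hl3 : 0 < l3)
    (hzeta : exists k : int, zeta = 2 * pi / l3 * k%:~R)
    (nu : R) (hnu1 : 1 < nu) (hnu2 : nu < 2) :
  exists kappa1 kappa2 : R, [/\ 0 < kappa1, 0 < kappa2 &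
    forall phi : spinor_field R, Lp_field l1 l2 4 phi ->
      Lnorm_field l1 l2 4 phi = 1%E ->
      (Lnorm_torus l1 l2 nu (bar_density phi) <= kappa1%:E)%E ->
      (kappa2%:E <= Lnorm_field l1 l2 4 (Pr_perp m l1 l2 zeta phi))%E].
Proof.
pose lam := Num.sqrt (zeta ^+ 2 + m ^+ 2).
have lamE : lam ^+ 2 = zeta ^+ 2 + m ^+ 2.
  by rewrite sqr_sqrtr// addr_ge0 ?sqr_ge0.
have lam0 : 0 < lam.
  by rewrite sqrtr_gt0 ltr_wpDl ?sqr_ge0// exprn_gt0.
pose T := l1 * l2; have T0 : 0 < T by rewrite mulr_gt0.
(* bar c = 2 t |c|^2 on the eigenspace *)
pose t := m / (2 * lam); have t0 : 0 < t by rewrite divr_gt0// mulr_gt0.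
pose K := 1 + t^-1; have K0 : 0 < K by rewrite addr_gt0// invr_gt0.
(* |c|^2 T is at least sqrt T / 4, so G bounds t |c|^2 T from below; s, k1 and k2
   make each of the three terms of the upper bound at most G / 4. *)
pose G := t * Num.sqrt T / 4.
have sT0 : 0 < Num.sqrt T by rewrite sqrtr_gt0.
have G0 : 0 < G by rewrite divr_gt0// mulr_gt0.
pose s := G / (4 * T * (1 + K)).
have s0 : 0 < s by rewrite divr_gt0// !mulr_gt0// addr_gt0.
have p0 : 0 < s `^ (nu - 1) by exact: powR_gt0.
have nu0 : 0 < nu by exact: lt_trans hnu1.
pose k1 := (s `^ (nu - 1) * (G / 4)) `^ nu^-1.
have k10 : 0 < k1 by rewrite powR_gt0// mulr_gt0// divr_gt0.
pose k2 := Num.min (1 / 2) (s * (G / 4) / K).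
have k20 : 0 < k2 by rewrite lt_min divr_gt0//= divr_gt0// mulr_gt0// divr_gt0.
exists k1, k2; split => // phi [_ mphi _] phi1 hbar.
rewrite leNgt; apply/negP => hlt.
have k2half : k2 <= 1 / 2 by rewrite ge_min lexx.
have k24half : k2 ^+ 4 <= 1 / 16.
  have -> : 1 / 16 = (1 / 2) ^+ 4 :> R by field.
  by rewrite lerXn2r// nnegrE ltW.
have k24 : k2 ^+ 4 <= s * (G / 4) / K.
  rewrite (@le_trans _ _ k2)//; last by rewrite ge_min lexx orbT.
  by rewrite exprS ler_piMr ?exprn_ile1 ?ltW//; lra.
have [[w1 [w2 [H1 aeu]]]|Pr0] : Eigen m l1 l2 zeta lam (Pr m l1 l2 zeta phi) \/
    Pr m l1 l2 zeta phi = fun=> 0.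
- rewrite /Pr; case: xgetP => [p _ [Ep _]|_]; [by left|by right].
- have [c [uc ceq]] := eigen_constant l1 l2 hl1 hl2 m zeta lam _ w1 w2 lamE H1 aeu.
  have cE : bar c = 2 * t * nsq c.
    have := bar_eigen _ _ _ _ ceq => e.
    apply: (mulfI (lt0r_neq0 lam0)); rewrite e /t; field.
    by rewrite gt_eqF.
  have hB := Lnorm_torus_le l1 l2 nu k1 (bar_density phi) nu0 (ltW k10) hbar.
  have k1E : k1 `^ nu = s `^ (nu - 1) * (G / 4).
    by rewrite /k1 -powRrM mulVf ?gt_eqF// powRr1// ltW// mulr_gt0// divr_gt0.
  rewrite k1E in hB.
  have mp : measurable_field (Pr m l1 l2 zeta phi) by have [[]] := H1.
  have hQ : (torus_int l1 l2 (fun x => nsq (phi x - c) ^+ 2)%R <= (k2 ^+ 4)%:E)%E.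
    have := Lnorm_torus_le l1 l2 4 k2
      (fun x => spinor_norm (Pr_perp m l1 l2 zeta phi x)) (ltr0n _ 4) (ltW k20) (ltW hlt).
    rewrite powR_mulrn ?(ltW k20)// => /(le_trans _); apply.
    have nq w : measurable_field w -> nn_measurable (fun x => nsq (w x) ^+ 2).
      by move=> mw; split=> [x|]; [exact: sqr_ge0|
        exact: measurable_funX (nn_measurable_nsq _ mw).2].
    under [X in (_ <= torus_int _ _ X)%E]funext do rewrite spinor_norm_pow4.
    apply: torus_int_le_ae.
    + by apply: nq; apply: measurable_fieldB => //; exact: measurable_field_cst.
    + by apply: nq; apply: measurable_fieldB.
    by apply: torus_aeS uc => x; rewrite /Pr_perp => ->.
  have h1 := constant_part_le l1 l2 hl1 hl2 phi c t s nu _ _ mphi t0 cE s0 hnu1 hB hQ.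
  have hphi : torus_int l1 l2 (fun x => nsq (phi x) ^+ 2) = 1%E.
    have := Lnorm_torus_pow l1 l2 4 (fun x => spinor_norm (phi x)) (ltr0n _ 4).
    rewrite -[Lnorm_torus _ _ _ _]/(Lnorm_field l1 l2 4 phi) phi1 poweR_EFin powR1.
    by under [X in torus_int _ _ X]funext do rewrite spinor_norm_pow4.
  have h2 := L4_split_le l1 l2 hl1 hl2 phi c _ mphi hphi hQ.
  rewrite -/T in h1 h2; rewrite -/K in h1.
  have c0 := nsq_ge0 c.
  have big : Num.sqrt T / 4 <= nsq c * T.
    have n1 : 0 <= Num.sqrt T / 4 by rewrite divr_ge0// ltW.
    have n2 : 0 <= nsq c * T by rewrite mulr_ge0// ltW.
    rewrite -(@ler_pXn2r _ 2) ?nnegrE// expr_div_n sqr_sqrtr ?(ltW T0)//.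
    have -> : (nsq c * T) ^+ 2 = (nsq c ^+ 2 * T) * T by ring.
    have : 1 / 16 <= nsq c ^+ 2 * T by lra.
    move=> /(ler_wpM2r (ltW T0)) /= h; apply: le_trans h; lra.
  have lo : G <= t * nsq c * T.
    rewrite /G -mulrA -[leRHS]mulrA; apply: ler_wpM2l; [exact: ltW|exact: big].
  have e1 : (s `^ (nu - 1))^-1 * (s `^ (nu - 1) * (G / 4)) = G / 4.
    by rewrite mulKf// gt_eqF.
  have e2 : s * T * (1 + K) = G / 4.
    rewrite /s; field; rewrite (gt_eqF T0) gt_eqF// addr_gt0//.
  have e3 : K * (s^-1 * k2 ^+ 4) <= G / 4.
    rewrite mulrCA -ler_pdivlMl ?invr_gt0// invrK -ler_pdivlMl//.
    by rewrite (le_trans k24)// mulrC.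
  rewrite e1 in h1; lra.
- have : Pr_perp m l1 l2 zeta phi = phi.
    by apply/funext => x; rewrite /Pr_perp Pr0 subr0.
  move=> E; move: hlt; rewrite E phi1 lte_fin; lra.
Qed.
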